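(* Let $\mathbf{L}\in Q(\mathbb{B}^n)$. An analytic function $F:\mathbb{B}^n\to\mathbb{C}$ has bounded $\mathbf{L}$-index in joint variables if and only if there exist $R=(r_1,\dots,r_n)$ with $r_j>0$ for all $j$ and $|R|\le\beta$, $n_0\in\mathbb{Z}_+$ and $p_0>1$ such that for each $z^0\in\mathbb{B}^n$ there is $K^0\in\mathbb{Z}^n_+$ with $\|K^0\|\le n_0$ and $$\max\left\{\frac{|F^{(K)}(z)|}{K!\,\mathbf{L}^K(z)}:\ \|K\|\le n_0,\ z\in\mathbb{D}^n\left[z^0,R/\mathbf{L}(z^0)\right]\right\}\le p_0\,\frac{|F^{(K^0)}(z^0)|}{K^0!\,\mathbf{L}^{K^0}(z^0)}.$$
   Context: $\mathbb{R}_+=[0,\infty)$, $\mathbb{Z}_+=\{0,1,2,\dots\}$. $|\cdot|$ is the Euclidean norm on $\mathbb{C}^n$ (and on $\mathbb{R}^n$); $\mathbb{B}^n=\{z\in\mathbb{C}^n:|z|<1\}$. For $K\in\mathbb{Z}^n_+$: $\|K\|=k_1+\dots+k_n$, $K!=k_1!\cdots k_n!$, $A^K=a_1^{k_1}\cdots a_n^{k_n}$, and $F^{(K)}=\partial^{\|K\|}F/\partial z_1^{k_1}\cdots\partial z_n^{k_n}$. Quotients $A/B$ of vectors are componentwise. $\mathbb{D}^n[z^0,R]=\{z:|z_j-z^0_j|\le r_j,\ j=1,\dots,n\}$ for $R=(r_1,\dots,r_n)\in\mathbb{R}^n_+$. Fix a constant $\beta>\sqrt n$. Throughout, $\mathbf{L}(z)=(l_1(z),\dots,l_n(z))$,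 where each $l_j:\mathbb{B}^n\to\mathbb{R}_+$ is continuous and $l_j(z)>\beta/(1-|z|)$ for all $z\in\mathbb{B}^n$. (Then $\mathbb{D}^n[z^0,R/\mathbf{L}(z^0)]\subset\mathbb{B}^n$ whenever $z^0\in\mathbb{B}^n$, $|R|\le\beta$.) $Q(\mathbb{B}^n)$ is the class of such $\mathbf{L}$ satisfying, for all $R\in\mathbb{R}^n_+$ with $|R|\le\beta$ and all $j$, $0<\lambda_{1,j}(R)\le\lambda_{2,j}(R)<\infty$, where $\lambda_{1,j}(R)$ and $\lambda_{2,j}(R)$ are respectively the infimum and the supremum of $l_j(z)/l_j(z^0)$ over all $z^0\in\mathbb{B}^n$ and $z\in\mathbb{D}^n[z^0,R/\mathbf{L}(z^0)]$. An analytic $F:\mathbb{B}^n\to\mathbb{C}$ is of bounded $\mathbf{L}$-index in joint variables if there is $m\in\mathbb{Z}_+$ such that for all $z\in\mathbb{B}^n$ and $J\in\mathbb{Z}^n_+$: $\frac{|F^{(J)}(z)|}{J!\mathbf{L}^J(z)}\le\max\{\frac{|F^{(K)}(z)|}{K!\mathbf{L}^K(z)}:K\in\mathbb{Z}^n_+,\|K\|\le m\}$. *)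

(* Defs.v *)
From HB Require Import structures.
From mathcomp Require Import all_boot all_order all_algebra.
From mathcomp Require Import all_classical all_reals all_analysis.
From mathcomp.real_closed Require Import complex.
From mathcomp.analysis.showcase Require Import summability.

Set Implicit Arguments.
Unset Strict Implicit.
Unset Printing Implicit Defensive.

Import Order.TTheory GRing.Theory Num.Theory numFieldNormedType.Exports.

Local Open Scope classical_set_scope.
Local Open Scope ring_scope.
Local Open Scope complex_scope.

(* The standard topology and norm of the field R[i], as numFieldNormedType
   does for abstract number fields. *)
#[non_forgetful_inheritance]
HB.instance Definition _ (R : realType) := NormedModule.copy R[i] (R[i]^o).

(* The R-valued modulus; the norm of R[i] takes its values in R[i]. *)
Definition cabs (R : realType) (z : R[i]) : R := ComplexField.Normc.normc z.

(* Euclidean norms; the norm of the normed module 'rV_n is the sup norm. *)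
Definition enorm (R : realType) n (x : 'rV[R]_n) : R :=
  Num.sqrt (\sum_(j < n) x 0 j ^+ 2).

Definition cnorm (R : realType) n (z : 'rV[R[i]]_n) : R :=
  enorm (map_mx (@cabs R) z).

Definition unit_ball (R : realType) n : set 'rV[R[i]]_n :=
  [set z | cnorm z < 1].

Arguments unit_ball R n : clear implicits.

Definition polydisc (R : realType) n (z0 : 'rV[R[i]]_n) (r : 'rV[R]_n) :
    set 'rV[R[i]]_n :=
  [set z | forall j, cabs (z 0 j - z0 0 j) <= r 0 j].

Definition vquot (R : realType) n (a b : 'rV[R]_n) : 'rV[R]_n :=
  \row_j (a 0 j / b 0 j).

Definition multiindex n := {ffun 'I_n -> nat}.

Definition mdeg n (K : multiindex n) : nat := (\sum_(j < n) K j)%N.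

Definition mfact n (K : multiindex n) : nat := (\prod_(j < n) (K j)`!)%N.

Definition mpow (A : comNzRingType) n (a : 'rV[A]_n) (K : multiindex n) : A :=
  \prod_(j < n) a 0 j ^+ K j.

(* Functions on the unit ball are total functions whose values outside the
   (open) ball are irrelevant. *)

(* Near every point of the ball, F is the sum of a power series; [totally] is
   the filter of finite sets of multi-indices directed by inclusion, so that
   convergence is unconditional. *)
Definition analytic_on_ball (R : realType) n (F : 'rV[R[i]]_n -> R[i]) : Prop :=
  forall a, unit_ball R n a -> exists c : multiindex n -> R[i],
    \forall z \near a,
      partial_sum (fun K : multiindex n => c K * mpow (z - a) K) @ totally
        --> F z.

Definition partial_derive (R : realType) n (j : 'I_n)
    (F : 'rV[R[i]]_n -> R[i]) : 'rV[R[i]]_n -> R[i] :=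
  fun z => 'D_(delta_mx 0 j) F z.

Definition mderive (R : realType) n (F : 'rV[R[i]]_n -> R[i])
    (K : multiindex n) : 'rV[R[i]]_n -> R[i] :=
  foldr (fun j => iter (K j) (partial_derive j)) F (enum 'I_n).

Definition normalized_derive (R : realType) n
    (L : 'rV[R[i]]_n -> 'rV[R]_n) (F : 'rV[R[i]]_n -> R[i])
    (K : multiindex n) (z : 'rV[R[i]]_n) : R :=
  cabs (mderive F K z) / ((mfact K)%:R * mpow (L z) K).

Definition ratio_set (R : realType) n (L : 'rV[R[i]]_n -> 'rV[R]_n)
    (r : 'rV[R]_n) (j : 'I_n) : set (\bar R) :=
  [set x | exists z0 z, [/\ unit_ball R n z0,
     polydisc z0 (vquot r (L z0)) z & x = (L z 0 j / L z0 0 j)%:E]].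

Definition lambda1 (R : realType) n (L : 'rV[R[i]]_n -> 'rV[R]_n)
    (r : 'rV[R]_n) (j : 'I_n) : \bar R := ereal_inf (ratio_set L r j).

Definition lambda2 (R : realType) n (L : 'rV[R[i]]_n -> 'rV[R]_n)
    (r : 'rV[R]_n) (j : 'I_n) : \bar R := ereal_sup (ratio_set L r j).

Definition class_Q (R : realType) n (beta : R)
    (L : 'rV[R[i]]_n -> 'rV[R]_n) : Prop :=
  [/\ forall j, {within unit_ball R n, continuous (fun z => L z 0 j)},
      forall j z, unit_ball R n z -> 0 <= L z 0 j,
      forall j z, unit_ball R n z -> beta / (1 - cnorm z) < L z 0 j
    & forall r : 'rV[R]_n, (forall j, 0 <= r 0 j) -> enorm r <= beta ->
        forall j, [/\ (0 < lambda1 L r j)%E, (lambda1 L r j <= lambda2 L r j)%E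
                    & (lambda2 L r j < +oo)%E]].

(* The multi-indices of degree at most m have entries at most m, hence the
   enumeration by {ffun 'I_n -> 'I_m.+1}; the maximum is over a nonempty set of
   nonnegative numbers, so that the default value 0 is harmless. *)
Definition bounded_L_index (R : realType) n (L : 'rV[R[i]]_n -> 'rV[R]_n)
    (F : 'rV[R[i]]_n -> R[i]) : Prop :=
  exists m : nat, forall (z : 'rV[R[i]]_n) (J : multiindex n),
    unit_ball R n z ->
    normalized_derive L F J z <=
      \big[Num.max/0]_(K : {ffun 'I_n -> 'I_m.+1} |
                         (mdeg [ffun j => K j : nat] <= m)%N)
         normalized_derive L F [ffun j => K j : nat] z.

(* For F analytic and L in the class Q this supremum is a maximum: it bears on
   finitely many continuous functions on a compact polydisc. *)
Definition polydisc_max (R : realType) n (L : 'rV[R[i]]_n -> 'rV[R]_n)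
    (F : 'rV[R[i]]_n -> R[i]) (n0 : nat) (z0 : 'rV[R[i]]_n) (r : 'rV[R]_n) :
    \bar R :=
  ereal_sup [set x | exists (K : multiindex n) (z : 'rV[R[i]]_n),
    [/\ (mdeg K <= n0)%N, polydisc z0 (vquot r (L z0)) z
      & x = (normalized_derive L F K z)%:E]].

(* Main.v *)
Require Import Defs.
From HB Require Import structures.
From mathcomp Require Import all_boot all_order all_algebra.
From mathcomp Require Import finmap.
From mathcomp Require Import all_classical all_reals all_analysis.
From mathcomp.real_closed Require Import complex.
From mathcomp.analysis.showcase Require Import summability.
From mathcomp Require Import ring lra.

(** Why the equivalence holds.

    Both directions rest on comparing the normalized derivatives at nearby
    points, and on the fact that over a polydisc [D[z0, R/L(z0)]] the vector [L]
    stays within constant factors of [L(z0)] ([class_Q_ratio]).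

    Bounded index implies the polydisc condition. Let [m] bound the index. Keep
    the normalizing vector [L(z0)] and move along a segment parallel to a
    coordinate axis. The derivatives of order at most [m] have as their velocities
    derivatives of order at most [m + 1], which the bounded index controls by the
    derivatives of order at most [m] themselves. This is a Gronwall situation,
    and if the radii are small enough each coordinate move at most doubles the
    maximum of the normalized derivatives ([family_growth],
    [coordinate_growth]); after [n] moves it has grown by a factor [2 ^+ n] at
    most ([polydisc_growth]). The argument uses that the partial derivatives of
    [F] are complex differentiable and commute.

    The polydisc condition implies bounded index. The radii in the hypothesis may
    be smaller than [1], but the condition can be iterated along a chain of
    finitely many points, their number not depending on [z0], which bounds [F] on
    the polydisc with all radii [c = beta / sqrt n] by a constant times the
    maximum of the normalized derivatives of order at most [n0] at the centre
    ([polydisc_chain]). Since [c > 1], Cauchy's estimate there gives a bound for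
    the derivatives of order [J] that decays like [c ^- mdeg J], and the constant
    is beaten as soon as [J] is large ([bounded_index_of_growth]).

    The analytic tools are built from the local power series. The remainder of
    order two of a monomial is dominated by the monomial itself at a doubled
    radius, so power series are differentiable term by term
    ([psum_remainder], [psum_deriv]); partial derivatives commute because the
    operators on the coefficients do ([partial_mderive]).

    Cauchy's estimate with the sharp constant is obtained on a disc without
    integration. Averages over the [N]-th roots of unity replace the integrals:
    the radial derivative of such an average is a Riemann sum whose main part
    telescopes, so averages are nearly equal to the value at the centre
    ([average_near_center]). Applied to the [k]-th derivative this says that the
    [k]-th Fourier coefficient on circles is nearly a monomial in the radius
    ([fourier_coef_approx]), and letting the root tend to [1] gives the estimate
    ([cauchy_disc]), which is then iterated over the coordinates
    ([cauchy_polydisc]). *)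

Set Implicit Arguments.
Unset Strict Implicit.
Unset Printing Implicit Defensive.

Import Order.TTheory GRing.Theory Num.Theory numFieldNormedType.Exports.

Local Open Scope classical_set_scope.
Local Open Scope ring_scope.
Local Open Scope complex_scope.

(** * Complex moduli and neighbourhoods *)

Section Modulus.
Variable R : realType.
Implicit Types z w : R[i].

Lemma cabs_norm z : `|z| = (cabs z)%:C. Proof. by []. Qed.

Lemma cabs0 : cabs (0 : R[i]) = 0. Proof. exact: ComplexField.Normc.normc0. Qed.

Lemma cabs1 : cabs (1 : R[i]) = 1. Proof. exact: ComplexField.Normc.normc1. Qed.

Lemma cabsM z w : cabs (z * w) = cabs z * cabs w.
Proof. exact: ComplexField.Normc.normcM. Qed.

Lemma cabsV z : cabs z^-1 = (cabs z)^-1.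
Proof. exact: ComplexField.Normc.normcV. Qed.

Lemma cabsX z k : cabs (z ^+ k) = cabs z ^+ k.
Proof.
by elim: k => [|k IH]; rewrite ?expr0 ?cabs1// !exprS cabsM IH.
Qed.

Lemma cabs_ge0 z : 0 <= cabs z.
Proof. by case: z => a b; exact: sqrtr_ge0. Qed.

Lemma cabsD z w : cabs (z + w) <= cabs z + cabs w.
Proof. by have := ler_normD z w; rewrite !cabs_norm -rmorphD/= lecR. Qed.

Lemma cabsN z : cabs (- z) = cabs z.
Proof. by have := normrN z; rewrite !cabs_norm => -[]. Qed.

Lemma cabsBC z w : cabs (z - w) = cabs (w - z).
Proof. by rewrite -cabsN opprB. Qed.

Lemma cabsB z w : cabs (z - w) <= cabs z + cabs w.
Proof. by rewrite -(cabsN w); exact: cabsD. Qed.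

Lemma cabs_le_dist z w : cabs z <= cabs w + cabs (z - w).
Proof. by have := cabsD w (z - w); rewrite addrC subrK. Qed.

Lemma cabs_eq0 z : cabs z = 0 -> z = 0.
Proof. exact: ComplexField.Normc.eq0_normc. Qed.

Lemma cabs_real (x : R) : cabs x%:C = `|x|.
Proof. by rewrite /cabs/= expr0n/= addr0 sqrtr_sqr. Qed.

Lemma cabs_nat k : cabs (k%:R : R[i]) = k%:R.
Proof. by rewrite -(rmorph_nat (real_complex R)) cabs_real ger0_norm. Qed.

Lemma cabs_sum (I : Type) (s : seq I) (P : pred I) (f : I -> R[i]) :
  cabs (\sum_(i <- s | P i) f i) <= \sum_(i <- s | P i) cabs (f i).
Proof.
apply: (big_ind2 (fun z x => cabs z <= x)); rewrite ?cabs0// => z x w y zx wy.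
by rewrite (le_trans (cabsD _ _)) ?lerD.
Qed.

Lemma cabs_prod (I : Type) (s : seq I) (P : pred I) (f : I -> R[i]) :
  cabs (\prod_(i <- s | P i) f i) = \prod_(i <- s | P i) cabs (f i).
Proof. exact: (big_morph _ cabsM cabs1). Qed.

Lemma le_cabs_cpx (x y : R) : cabs (x +i* y) <= `|x| + `|y|.
Proof.
have -> : x +i* y = x%:C + (0 +i* y) by rewrite -[RHS]/(_ +i* _) addr0 add0r.
rewrite (le_trans (cabsD _ _))// cabs_real lerD2l.
by rewrite /cabs/= expr0n/= add0r sqrtr_sqr.
Qed.

Lemma cabs_Re z : `|complex.Re z| <= cabs z.
Proof.
by case: z => a b; rewrite /cabs/= -sqrtr_sqr ler_wsqrtr// lerDl sqr_ge0.
Qed.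

Lemma cabs_Im z : `|complex.Im z| <= cabs z.
Proof.
by case: z => a b; rewrite /cabs/= -sqrtr_sqr ler_wsqrtr// lerDr sqr_ge0.
Qed.

Lemma cabs_lt_norm z (e : R[i]) : 0 < e -> (`|z| < e) = (cabs z < complex.Re e).
Proof.
case: e => e1 e2; rewrite cabs_norm ltcE/= => /andP[/eqP-> _].
by rewrite ltcE/= eqxx.
Qed.

Lemma Re_gt0 (e : R[i]) : 0 < e -> 0 < complex.Re e.
Proof. by rewrite ltcE => /andP[]. Qed.

(** The balls defining the topology have radii in [R[i]]; positivity forces them
    to be real. *)
Lemma near_row n (a : 'rV[R[i]]_n) (P : 'rV[R[i]]_n -> Prop) :
  (\forall z \near a, P z) <->
  exists2 d : R, 0 < d &
    forall y : 'rV[R[i]]_n, (forall j, cabs (y 0 j) < d) -> P (a + y).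
Proof.
split.
  move=> /nbhs_ballP[e /= e0 He]; exists (complex.Re e); first exact: Re_gt0.
  move=> y Hy; apply: He; split=> // i j; rewrite (ord1 i) -ball_normE /=.
  by rewrite mxE opprD addNKr normrN cabs_lt_norm.
move=> [d d0 Hd]; apply/nbhs_ballP; exists (d%:C) => /=; first by rewrite ltcR.
move=> z [_ Hz]; rewrite -[z](addrNK a) addrC; apply: Hd => j.
have := Hz 0 j; rewrite -ball_normE /= distrC cabs_lt_norm ?ltcR//.
by rewrite !mxE.
Qed.

End Modulus.

(** * Unconditional sums *)

Lemma ler_sum_fset (R : realType) (I : choiceType) (g : I -> R)
    (A B : {fset I}) : (forall i, 0 <= g i) -> (A `<=` B)%fset ->
  \sum_(i <- A) g i <= \sum_(i <- B) g i.
Proof.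
move=> g0 AB; pose h i := if i \in A then g i else 0.
have -> : \sum_(i <- A) g i = \sum_(i <- A) h i.
  by apply: eq_big_seq => i iA; rewrite /h iA.
rewrite (big_fset_incl _ AB) => [|i _ /negbTE iA]; last by rewrite /h iA.
by apply: ler_sum => i _; rewrite /h; case: ifP.
Qed.

Section UnconditionalSums.
Variables (R : realType) (I : choiceType).
Implicit Types (f g : I -> R[i]) (A B : {fset I}).

Definition usum f (l : R[i]) := forall e : R, 0 < e ->
  exists A, forall B, (A `<=` B)%fset -> cabs (\sum_(i <- B) f i - l) < e.

Lemma cvg_usum f l : (partial_sum f @ totally --> l) <-> usum f l.
Proof.
have psE B : partial_sum f B = \sum_(i <- B) f i by rewrite /partial_sum big_seq_fsetE.
have FF : Filter (@totally I) := @totally_filter I.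
split.
  move=> /cvgrPdist_lt fl e e0.
  have e0C : 0 < e%:C by rewrite ltcR.
  have [A _ HA] := fl _ e0C; exists A => B /HA /=; rewrite psE.
  by rewrite cabs_lt_norm ?ltcR// cabsBC.
move=> fl; apply/cvgrPdist_lt => e e0; have [A HA] := fl _ (Re_gt0 e0).
by exists A => // B /HA /=; rewrite psE cabs_lt_norm// cabsBC.
Qed.

Lemma usum_bounded f l : usum f l -> exists M, forall i, cabs (f i) <= M.
Proof.
move=> /(_ 1 ltr01)[A HA]; exists (2 + \sum_(i <- A) cabs (f i)) => i.
have [iA|iA] := boolP (i \in A).
  rewrite (big_fsetD1 i)//= addrCA lerDl addr_ge0//.
  by apply: sumr_ge0 => j _; exact: cabs_ge0.
have -> : f i = (\sum_(j <- (i |` A)%fset) f j - l) - (\sum_(j <- A) f j - l).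
  by rewrite big_fsetU1//=; ring.
apply: (le_trans (cabsB _ _)).
have S0 : 0 <= \sum_(j <- A) cabs (f j) by apply: sumr_ge0 => j _; exact: cabs_ge0.
have := HA _ (fsubset_refl A); have := HA _ (fsubsetU1 i A); lra.
Qed.

Lemma usumD f g l m : usum f l -> usum g m -> usum (fun i => f i + g i) (l + m).
Proof.
move=> fl gm e e0; have e2 : 0 < e / 2 by rewrite divr_gt0.
have [A HA] := fl _ e2; have [B HB] := gm _ e2.
exists (A `|` B)%fset => C; rewrite fsubUset => /andP[/HA AC /HB BC].
rewrite big_split/= opprD addrACA (le_lt_trans (cabsD _ _))//.
by rewrite (splitr e) ltrD.
Qed.

Lemma usumZ (a : R[i]) f l : usum f l -> usum (fun i => a * f i) (a * l).
Proof.
move=> fl e e0; have a0 : 0 < cabs a + 1 by rewrite ltr_wpDl ?cabs_ge0.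
have [A HA] := fl _ (divr_gt0 e0 a0).
exists A => B /HA; rewrite -mulr_sumr -mulrBr cabsM ltr_pdivlMr// mulrC.
apply: le_lt_trans; rewrite ler_wpM2r ?cabs_ge0// lerDl//.
Qed.

Lemma usumB f g l m : usum f l -> usum g m -> usum (fun i => f i - g i) (l - m).
Proof.
move=> fl /(usumZ (-1)) /(usumD fl); rewrite mulN1r.
by under eq_fun do rewrite mulN1r.
Qed.

Lemma usum_le f l M :
  usum f l -> (forall A, cabs (\sum_(i <- A) f i) <= M) -> cabs l <= M.
Proof.
move=> fl fM; rewrite leNgt; apply/negP => Ml.
have /fl[A /(_ A (fsubset_refl _))] : 0 < cabs l - M by rewrite subr_gt0.
by rewrite cabsBC; have := cabs_le_dist l (\sum_(i <- A) f i); have := fM A; lra.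
Qed.

Lemma usum_unique f l m : usum f l -> usum f m -> l = m.
Proof.
move=> fl fm; apply/subr0_eq/cabs_eq0/le_anti; rewrite cabs_ge0 andbT.
apply: (usum_le (usumB fl fm)) => A.
by rewrite big1 ?cabs0// => i _; rewrite subrr.
Qed.

Let usum_nonneg (g : I -> R) (M : R) : (forall i, 0 <= g i) ->
  (forall A, \sum_(i <- A) g i <= M) -> exists l, usum (fun i => (g i)%:C) l.
Proof.
move=> g0 gM; pose E := [set \sum_(i <- A) g i | A in [set: {fset I}]].
have hsE : has_sup E.
  by split; [exists (\sum_(i <- fset0) g i), fset0|exists M => _ [A _ <-]].
exists (sup E)%:C => e e0; have [_ [A _ <-] HA] := sup_adherent e0 hsE.
exists A => B AB.
have -> : \sum_(i <- B) (g i)%:C - (sup E)%:C = (\sum_(i <- B) g i - sup E)%:C.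
  by rewrite rmorphB/= rmorph_sum.
rewrite cabs_real ltr_norml.
have := sup_upper_bound hsE => /(_ (\sum_(i <- B) g i)) Bs.
have {}Bs : \sum_(i <- B) g i <= sup E by apply: Bs; exists B.
have AB' := ler_sum_fset g0 AB.
by lra.
Qed.

(** Completeness of the reals enters through suprema: a bounded family of
    nonnegative reals has a sum, and a complex family is a combination of four
    such families. *)
Lemma usum_exists f M :
  (forall A, \sum_(i <- A) cabs (f i) <= M) -> exists l, usum f l.
Proof.
move=> fM.
have real_case (g : I -> R) : (forall i, `|g i| <= cabs (f i)) ->
    exists l, usum (fun i => (g i)%:C) l.
  move=> gf.
  have [|A|p Hp] := @usum_nonneg (fun i => g i + `|g i|) (M + M).
  - by move=> i; have := ler_norm (- g i); rewrite normrN; lra.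
  - rewrite big_split/= lerD// (le_trans _ (fM A))//; apply: ler_sum => i _ //.
    exact: le_trans (ler_norm _) (gf i).
  have [|A|q Hq] := @usum_nonneg (fun i => `|g i|) M => //.
  - by rewrite (le_trans _ (fM A))//; apply: ler_sum => i _.
  exists (p - q); have := usumB Hp Hq.
  by under eq_fun do rewrite -rmorphB/= addrK.
have [p Hp] := real_case _ (fun i => cabs_Re (f i)).
have [q Hq] := real_case _ (fun i => cabs_Im (f i)).
exists (p + 'i%C * q); have := usumD Hp (usumZ 'i%C Hq).
by under eq_fun do rewrite -complexE.
Qed.

End UnconditionalSums.

Lemma usum_reindex (R : realType) (I J : choiceType) (f : I -> R[i]) (l : R[i])
    (phi : J -> I) (psi : I -> J) : cancel phi psi ->
  (forall i, phi (psi i) != i -> f i = 0) -> usum f l -> usum (f \o phi) l.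
Proof.
move=> phiK f0 fl e /fl[A HA]; exists (psi @` A)%fset => B AB.
have -> : \sum_(j <- B) (f \o phi) j = \sum_(i <- (phi @` B `|` A)%fset) f i.
  rewrite -(big_fset_incl _ (fsubsetUl (phi @` B) A)%fset) => [|i].
    by rewrite big_imfset//= => x y _ _; exact: (can_inj phiK).
  rewrite in_fsetU => /orP[->//|iA] iB; apply/f0/negP => /eqP phii.
  move/negP: iB; apply; rewrite -phii in_imfset//=.
  by apply: (fsubsetP AB); rewrite in_imfset.
by apply: HA; exact: fsubsetUr.
Qed.

(** * Monomials and geometric series *)

Lemma bernoulli_remainder (R : realType) (x d : R) k : 0 <= x -> 0 <= d ->
  x ^+ k + k%:R * d * x ^+ k.-1 <= (x + d) ^+ k.
Proof.
move=> x0 d0; elim: k => [|k IH]; first by rewrite !expr0 !mul0r addr0.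
have xd0 : 0 <= x + d by rewrite addr_ge0.
rewrite [leRHS]exprS; apply: le_trans (ler_wpM2l xd0 IH).
have -> : (x + d) * (x ^+ k + k%:R * d * x ^+ k.-1) =
    x ^+ k.+1 + k.+1%:R * d * x ^+ k + k%:R * d ^+ 2 * x ^+ k.-1.
  by case: k {IH} => [|k] /=; rewrite -?natr1 !exprS ?expr0; ring.
by rewrite lerDl !mulr_ge0 ?exprn_ge0.
Qed.

(** The comparison with the same remainder at the moduli, scaled by
    [(cabs h / d) ^+ 2], loses nothing under multiplication by [w + h], which is
    what the induction needs. *)
Lemma binomial_remainder (R : realType) (w h : R[i]) (d : R) k :
  0 < d -> cabs h <= d ->
  cabs ((w + h) ^+ k - w ^+ k - k%:R * h * w ^+ k.-1) * d ^+ 2 <=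
    cabs h ^+ 2 * (cabs w + d) ^+ k.
Proof.
move=> d0 hd; set x := cabs w; have x0 : 0 <= x := cabs_ge0 w.
suff : cabs ((w + h) ^+ k - w ^+ k - k%:R * h * w ^+ k.-1) * d ^+ 2 <=
    cabs h ^+ 2 * ((x + d) ^+ k - x ^+ k - k%:R * d * x ^+ k.-1).
  move=> /le_trans; apply; rewrite ler_wpM2l ?exprn_ge0 ?cabs_ge0//.
  have : 0 <= x ^+ k + k%:R * d * x ^+ k.-1.
    by rewrite addr_ge0// ?mulr_ge0// ?exprn_ge0// ltW.
  by lra.
elim: k => [|k IH].
  by rewrite !expr0 !mulr0n !mul0r !subr0 !subrr cabs0 mul0r mulr0 lexx.
have -> : (w + h) ^+ k.+1 - w ^+ k.+1 - k.+1%:R * h * w ^+ k =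
    (w + h) * ((w + h) ^+ k - w ^+ k - k%:R * h * w ^+ k.-1)
    + k%:R * h ^+ 2 * w ^+ k.-1.
  by case: k {IH} => [|k] /=; rewrite -?natr1 !exprS ?expr0; ring.
have -> : (x + d) ^+ k.+1 - x ^+ k.+1 - k.+1%:R * d * x ^+ k =
    (x + d) * ((x + d) ^+ k - x ^+ k - k%:R * d * x ^+ k.-1)
    + k%:R * d ^+ 2 * x ^+ k.-1.
  by case: k {IH} => [|k] /=; rewrite -?natr1 !exprS ?expr0; ring.
apply: (@le_trans _ _ ((cabs (w + h) *
    cabs ((w + h) ^+ k - w ^+ k - k%:R * h * w ^+ k.-1)
    + k%:R * cabs h ^+ 2 * x ^+ k.-1) * d ^+ 2)).
  rewrite ler_wpM2r ?exprn_ge0 ?(ltW d0)//; apply: (le_trans (cabsD _ _)).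
  by rewrite !cabsM !cabsX cabs_nat.
rewrite mulrDl mulrDr; apply: lerD.
  rewrite -mulrA [leRHS]mulrCA.
  apply: ler_pM IH; rewrite ?cabs_ge0//.
    by rewrite !mulr_ge0 ?cabs_ge0 ?exprn_ge0 ?(ltW d0).
  by rewrite (le_trans (cabsD _ _))// lerD2l.
by rewrite le_eqVlt; apply/orP; left; apply/eqP; ring.
Qed.

Section Geometric.
Variable R : realType.

Lemma geometric_half m : \sum_(k < m) (2^-1 : R) ^+ k <= 2.
Proof.
suff -> : \sum_(k < m) (2^-1 : R) ^+ k = 2 - 2 * 2^-1 ^+ m.
  by rewrite gerBl mulr_ge0// exprn_ge0// invr_ge0.
elim: m => [|m IH]; first by rewrite big_ord0 expr0; ring.
by rewrite big_ord_recr/= IH exprS; field.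
Qed.

Lemma expr_mdeg (x : R) n (K : multiindex n) :
  x ^+ mdeg K = \prod_(j < n) x ^+ K j.
Proof. by rewrite prodrXr. Qed.

(** A finite set of multi-indices lies in a box, over which the sum factors into
    geometric sums in each coordinate. *)
Lemma geometric_multi n (A : {fset multiindex n}) :
  \sum_(K <- A) (2^-1 : R) ^+ mdeg K <= 2 ^+ n.
Proof.
pose m := (\max_(K <- A) mdeg K)%N.
pose emb (K : {ffun 'I_n -> 'I_m.+1}) : multiindex n := [ffun j => K j : nat].
have emb_inj : injective emb.
  move=> K K' /ffunP KK; apply/ffunP => j; apply/val_inj.
  by have := KK j; rewrite !ffunE.
have AB : (A `<=` [fset emb K | K in {: {ffun 'I_n -> 'I_m.+1}}])%fset.
  apply/fsubsetP => K KA; apply/imfsetP => /=.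
  exists [ffun j => inord (K j)]; first by rewrite inE.
  apply/ffunP => j; rewrite !ffunE inordK// ltnS.
  rewrite (@leq_trans (mdeg K))//; first by rewrite /mdeg (bigD1 j)//= leq_addr.
  by rewrite /m; exact: leq_bigmax_seq.
apply: (le_trans (ler_sum_fset _ AB)) => [K|]; first by rewrite exprn_ge0// invr_ge0.
rewrite big_imfset/=; last by move=> K K' _ _; exact: emb_inj.
rewrite big_enum/= (eq_bigl xpredT) => [|K]; last by rewrite inE.
under eq_bigr do rewrite expr_mdeg.
under eq_bigr do under eq_bigr do rewrite ffunE.
rewrite -(bigA_distr_bigA (fun _ (k : 'I_m.+1) => 2^-1 ^+ k)).
have -> : 2 ^+ n = \prod_(j < n) (2 : R) by rewrite prodr_const card_ord.
rewrite ler_prod// => j _.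
by rewrite geometric_half sumr_ge0// => k _; rewrite exprn_ge0// invr_ge0.
Qed.

End Geometric.

(** * Power series in several variables *)

Section PowerSeries.
Variables (R : realType) (n : nat).
Implicit Types (F : 'rV[R[i]]_n -> R[i]) (a y : 'rV[R[i]]_n) (j : 'I_n).
Implicit Types (c : multiindex n -> R[i]) (K : multiindex n).

Definition psum_at F a c := exists2 d : R, 0 < d &
  forall y, (forall j, cabs (y 0 j) < d) ->
    usum (fun K => c K * mpow y K) (F (a + y)).

Lemma analytic_psum F : analytic_on_ball F <->
  forall a, unit_ball R n a -> exists c, psum_at F a c.
Proof.
have E a y : a + y - a = y by rewrite addrC addKr.
split=> HF a /HF[c Hc]; exists c.
  have [d d0 Hd] := (near_row _ _).1 Hc; exists d => // y /Hd/cvg_usum.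
  by rewrite E.
have [d d0 Hd] := Hc; apply/near_row; exists d => // y /Hd ?.
by apply/cvg_usum; rewrite E.
Qed.

Definition madd1 K j : multiindex n := [ffun i => (K i + (i == j))%N].

Definition deriv_coef j c K : R[i] := (K j).+1%:R * c (madd1 K j).

Let e j : 'rV[R[i]]_n := delta_mx 0 j.
Let others j y K := \prod_(i < n | i != j) y 0 i ^+ K i.
Let dmono j y K : R[i] := (K j)%:R * y 0 j ^+ (K j).-1 * others j y K.

Let mpowE j y K : mpow y K = y 0 j ^+ K j * others j y K.
Proof. by rewrite /mpow (bigD1 j). Qed.

Let mpow_shift j y h K :
  mpow (y + h *: e j) K = (y 0 j + h) ^+ K j * others j y K.
Proof.
rewrite (mpowE j) !mxE !eqxx /= mulr1; congr (_ * _); apply: eq_bigr => i ij.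
by rewrite !mxE (negbTE ij) andbF mulr0 addr0.
Qed.

(** Convergence at one point with equal moduli gives geometric decay of the
    coefficients, so everything below reduces to a geometric series. *)
Lemma psum_coef_bound F a c : psum_at F a c -> exists r M : R,
  [/\ 0 < r, 0 <= M, (forall y, (forall j, cabs (y 0 j) < r) ->
      usum (fun K => c K * mpow y K) (F (a + y)))
    & forall K, cabs (c K) * r ^+ mdeg K <= M].
Proof.
move=> [d d0 Hd]; have d2 : 0 < d / 2 by rewrite divr_gt0.
have yd j : cabs ((const_mx (d / 2)%:C : 'rV[R[i]]_n) 0 j) < d.
  by rewrite mxE cabs_real gtr0_norm// ltr_pdivrMr// ltr_pMr// ltr1n.
have [M HM] := usum_bounded (Hd _ yd); exists (d / 2), `|M|; split => //.
  move=> y Hy; apply: Hd => j.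
  by rewrite (lt_trans (Hy j))// ltr_pdivrMr// ltr_pMr// ltr1n.
move=> K; apply: le_trans (le_trans (HM K) (ler_norm M)).
rewrite cabsM /mpow cabs_prod expr_mdeg; under [in leRHS]eq_bigr do
  rewrite cabsX mxE cabs_real gtr0_norm//.
by [].
Qed.

(** The remainder of order two of each monomial is dominated by the monomial at
    doubled radius, hence by the geometric series; summing over the monomials,
    the termwise derivative is the derivative at every point near the centre. *)
Lemma psum_remainder F a c j : psum_at F a c -> exists s C : R,
  [/\ 0 < s, 0 <= C & forall y, (forall i, cabs (y 0 i) < s) ->
    exists2 g : R[i], usum (fun K => c K * dmono j y K) g &
      forall h, cabs h <= s ->
        cabs (F (a + y + h *: e j) - F (a + y) - h * g) <= C * cabs h ^+ 2].
Proof.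
move=> /psum_coef_bound[r [M [r0 M0 HF HM]]].
(* the doubled radius [2 * s] is half of [r], whence the ratio [1 / 2] below *)
have [s [s0 sr]] : exists s, 0 < s /\ r = 4 * s.
  by exists (r / 4); split; [rewrite divr_gt0|field].
have s2 : s ^- 2 >= 0 by rewrite invr_ge0 exprn_ge0// ltW.
exists s, (s ^- 2 * (M * 2 ^+ n)); split=> //.
  by rewrite !mulr_ge0// exprn_ge0.
move=> y Hy.
have dom K : cabs (c K) * ((cabs (y 0 j) + s) ^+ K j * cabs (others j y K)) <=
    M * 2^-1 ^+ mdeg K.
  apply: (@le_trans _ _ (cabs (c K) * (r / 2) ^+ mdeg K)).
    rewrite ler_wpM2l ?cabs_ge0// expr_mdeg (bigD1 j)//= ler_pM ?cabs_ge0//.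
    - by rewrite exprn_ge0// addr_ge0 ?cabs_ge0// ltW.
    - rewrite lerXn2r ?nnegrE//; first by rewrite addr_ge0 ?cabs_ge0// ltW.
        by rewrite divr_ge0// ltW.
      by have := Hy j; lra.
    rewrite /others cabs_prod ler_prod// => i _; rewrite cabs_ge0 cabsX/=.
    rewrite lerXn2r ?nnegrE ?cabs_ge0//; first by rewrite divr_ge0// ltW.
    by have := Hy i; lra.
  by rewrite exprMn mulrA ler_wpM2r// exprn_ge0// invr_ge0.
have [g Hg] : exists g, usum (fun K => c K * dmono j y K) g.
  apply: (@usum_exists _ _ _ (s^-1 * (M * 2 ^+ n))) => A.
  apply: le_trans (_ : s^-1 * (M * \sum_(K <- A) 2^-1 ^+ mdeg K) <= _); last first.
    by rewrite !ler_wpM2l ?invr_ge0 ?(ltW s0)// geometric_multi.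
  rewrite !mulr_sumr; apply: ler_sum => K _.
  rewrite ler_pdivlMl//; apply: le_trans (dom K).
  rewrite /dmono !cabsM cabs_nat cabsX mulrCA ler_wpM2l ?cabs_ge0//.
  rewrite !mulrA ler_wpM2r ?cabs_ge0//.
  have := bernoulli_remainder (K j) (cabs_ge0 (y 0 j)) (ltW s0).
  have : 0 <= cabs (y 0 j) ^+ K j by rewrite exprn_ge0 ?cabs_ge0.
  by move=> x0; apply: le_trans; rewrite [s * _]mulrC lerDr.
exists g => // h hs.
have Hyh i : cabs ((y + h *: e j) 0 i) < r.
  rewrite !mxE; apply: le_lt_trans (cabsD _ _) _.
  have : cabs (h * ((0 == 0 :> 'I_1) && (i == j))%:R) <= s.
    by case: (_ && _); rewrite ?mulr1// mulr0 cabs0 ltW.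
  by have := Hy i; lra.
have Hy' i : cabs (y 0 i) < r by apply: lt_trans (Hy i) _; lra.
rewrite -(addrA a y); have := usumB (usumB (HF _ Hyh) (HF _ Hy')) (usumZ h Hg).
move=> /usum_le; apply=> A; apply: le_trans (cabs_sum _ _ _) _.
apply: le_trans (_ : cabs h ^+ 2 * s ^- 2 * (M * \sum_(K <- A) 2^-1 ^+ mdeg K) <= _);
    last first.
  rewrite [leRHS]mulrC [leRHS]mulrA ler_wpM2l ?mulr_ge0 ?exprn_ge0 ?cabs_ge0//.
  by rewrite ler_wpM2l// geometric_multi.
rewrite !mulr_sumr; apply: ler_sum => K _.
apply: (@le_trans _ _ (cabs h ^+ 2 * s ^- 2 *
    (cabs (c K) * ((cabs (y 0 j) + s) ^+ K j * cabs (others j y K))))); last first.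
  by rewrite ler_wpM2l// mulr_ge0// exprn_ge0// cabs_ge0.
rewrite mpow_shift (mpowE j y) /dmono.
have -> : c K * ((y 0 j + h) ^+ K j * others j y K) -
    c K * (y 0 j ^+ K j * others j y K) -
    h * (c K * ((K j)%:R * y 0 j ^+ (K j).-1 * others j y K)) =
    ((y 0 j + h) ^+ K j - y 0 j ^+ K j - (K j)%:R * h * y 0 j ^+ (K j).-1) *
      (c K * others j y K) by ring.
rewrite !cabsM; set E := cabs (_ - _); set x := cabs (y 0 j) + s.
have -> : cabs h ^+ 2 * s ^- 2 * (cabs (c K) * (x ^+ K j * cabs (others j y K))) =
    cabs h ^+ 2 * x ^+ K j * s ^- 2 * (cabs (c K) * cabs (others j y K)) by ring.
rewrite ler_wpM2r ?mulr_ge0 ?cabs_ge0// ler_pdivlMr ?exprn_gt0//.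
exact: binomial_remainder.
Qed.

Lemma partial_derive_eq F z j (g : R[i]) (s C : R) : 0 < s -> 0 <= C ->
  (forall h, cabs h <= s ->
     cabs (F (z + h *: e j) - F z - h * g) <= C * cabs h ^+ 2) ->
  partial_derive j F z = g.
Proof.
move=> s0 C0 Hg; rewrite /partial_derive/derive; apply: cvg_lim => //.
apply/cvgrPdist_le => /= eps eps0; near=> h.
have h0 : h != 0 by near: h; exact: nbhs_dnbhs_neq.
have hs : cabs h <= s.
  rewrite -lecR -cabs_norm; near: h; apply: dnbhs0_le; by rewrite ltcR.
have heps : cabs h < complex.Re eps / (C + 1).
  rewrite -ltcR -cabs_norm; near: h; apply: dnbhs0_lt.
  by rewrite ltcR divr_gt0 ?Re_gt0// ltr_wpDl.
have ch0 : 0 < cabs h.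
  by rewrite lt_def cabs_ge0 andbT; apply: contra h0 => /eqP/cabs_eq0->.
have -> : g - h^-1 *: (F (h *: e j + z) - F z) =
    - (h^-1 * (F (z + h *: e j) - F z - h * g)).
  by rewrite [h *: _ + z]addrC -[h^-1 *: _]/(h^-1 * _); field.
rewrite normrN ltW// cabs_lt_norm// cabsM cabsV.
apply: (@le_lt_trans _ _ (C * cabs h)).
  by rewrite ler_pdivrMl// mulrCA -expr2 Hg.
have C1 : 0 < C + 1 by rewrite ltr_wpDl.
move: heps; rewrite ltr_pdivlMr// mulrC; apply: le_lt_trans.
by rewrite ler_wpM2r ?cabs_ge0// lerDl.
Unshelve. all: by end_near.
Qed.

(** All terms but the constant one vanish at the centre. *)
Lemma psum_value F a c : psum_at F a c -> F a = c [ffun=> 0%N].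
Proof.
move=> [d d0 Hd]; rewrite -[a]addr0.
have /Hd F0 : forall j, cabs ((0 : 'rV[R[i]]_n) 0 j) < d by move=> j; rewrite mxE cabs0.
apply: usum_unique F0 _ => eps eps0; exists [fset [ffun=> 0%N]]%fset => A.
rewrite fsub1set => A0; rewrite (big_fsetD1 _ A0)/=.
rewrite big_seq big1 => [|K].
  rewrite /mpow big1 => [|i _]; last by rewrite ffunE expr0.
  by rewrite mulr1 addr0 subrr cabs0.
rewrite in_fsetD1 => /andP[K0 _].
have [i Ki] : exists i, K i != 0%N.
  apply/existsP; apply: contraNT K0; rewrite negb_exists => /forallP K0.
  by apply/eqP/ffunP => i; rewrite ffunE; apply/eqP; have := K0 i; rewrite negbK.
by rewrite (mpowE i) mxE expr0n (negbTE Ki) mul0r mulr0.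
Qed.

Lemma psum_deriv F a c j : psum_at F a c ->
  psum_at (partial_derive j F) a (deriv_coef j c).
Proof.
move=> /(psum_remainder j)[s [C [s0 C0 HF]]]; exists s => // y /HF[g Hg Hrem].
rewrite (partial_derive_eq s0 C0 Hrem).
pose K1 (K : multiindex n) : multiindex n := [ffun i => (K i - (i == j))%N].
have := @usum_reindex _ _ _ _ _ (madd1^~ j) K1 _ _ Hg.
have cancelK : cancel (madd1^~ j) K1.
  by move=> K; apply/ffunP => i; rewrite !ffunE addnK.
have out K : madd1 (K1 K) j != K -> c K * dmono j y K = 0.
  have [Kj0 _|Kj] := eqVneq (K j) 0%N; first by rewrite /dmono Kj0 !mul0r mulr0.
  move=> /eqP[]; apply/ffunP => i; rewrite !ffunE subnK//.
  by case: eqP => // ->; rewrite lt0n.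
move=> /(_ cancelK out); congr (usum _ _); apply/funext => K /=.
rewrite /deriv_coef/dmono !ffunE eqxx addn1/= (mpowE j).
have -> : others j y (madd1 K j) = others j y K.
  by apply: eq_bigr => i /negbTE ij; rewrite ffunE ij addn0.
by ring.
Qed.

Lemma psum_cderiv F a c j : psum_at F a c -> forall eps, 0 < eps ->
  exists2 d, 0 < d & forall h, cabs h < d ->
    cabs (F (a + h *: e j) - F a - h * partial_derive j F a) <= eps * cabs h.
Proof.
move=> /(psum_remainder j)[s [C [s0 C0 HF]]] eps eps0.
have [|g _] := HF 0; first by move=> i; rewrite mxE cabs0.
rewrite addr0 => Hg; rewrite (partial_derive_eq s0 C0 Hg).
have C1 : 0 < C + 1 by rewrite ltr_wpDl.
exists (Num.min s (eps / (C + 1))); first by rewrite lt_min s0 divr_gt0.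
move=> h; rewrite lt_min ltr_pdivlMr// => /andP[hs heps].
apply: le_trans (Hg _ (ltW hs)) _; rewrite expr2 mulrA ler_wpM2r ?cabs_ge0//.
by apply: le_trans (ltW heps); rewrite mulrC ler_wpM2l ?cabs_ge0// lerDl.
Qed.

End PowerSeries.

(** * Complex-valued functions of a real parameter *)

Section RealVariable.
Variable R : realType.
Implicit Types (f g : R -> R[i]) (T t s : R).

(** Compactness of a segment in the form used here: a property of intervals that
    is additive and holds for all short intervals around each point holds for the
    whole segment. *)
Lemma cousin (P : R -> R -> Prop) T : 0 <= T ->
  (forall a c b, a <= c -> c <= b -> P a c -> P c b -> P a b) ->
  (forall t, 0 <= t <= T -> exists2 d : R, 0 < d &
     forall a b, 0 <= a -> a <= t -> t <= b -> b <= T -> b - a < d -> P a b) ->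
  P 0 T.
Proof.
move=> T0 Padd Ploc; pose S := [set t | 0 <= t <= T /\ P 0 t].
have S0 : S 0.
  split; first by rewrite lexx.
  by have [|d d0] := Ploc 0; [rewrite lexx|apply; rewrite ?subrr].
have hsS : has_sup S by split; [exists 0|exists T => t [/andP[_ ?] _]].
set s := sup S; have s0 : 0 <= s by exact: sup_upper_bound.
have sT : s <= T by apply: ge_sup => [|t [/andP[_ ?] _]]; first by exists 0.
have [|d d0 Hd] := Ploc s; first by rewrite s0.
have [u [/andP[u0 uT] Pu] su] := sup_adherent (divr_gt0 d0 (ltr0n R 2)) hsS.
have us : u <= s by apply: sup_upper_bound => //; split; rewrite ?u0.
have [Ts|Ts] := leP T (s + d / 3).
  by apply: (Padd _ u) => //; apply: Hd => //; rewrite -/s in su; lra.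
have Ss : S (s + d / 3).
  split; first by rewrite (ltW Ts) andbT; lra.
  by apply: (Padd _ u) => //; [lra|apply: Hd => //; rewrite -/s in su; lra].
by have := sup_upper_bound hsS Ss; rewrite -/s; lra.
Qed.

(** The scalar field of the target being [R[i]], derivatives along a real
    parameter are spelt out by first-order approximation. *)
Definition has_rderiv T f f' := forall t, 0 <= t <= T -> forall eps : R, 0 < eps ->
  exists2 d : R, 0 < d & forall s, 0 <= s <= T -> `|s - t| < d ->
    cabs (f s - f t - (s - t)%:C * f' t) <= eps * `|s - t|.

Lemma has_rderiv_le T T' f f' : T' <= T -> has_rderiv T f f' -> has_rderiv T' f f'.
Proof.
move=> TT ff t /andP[t0 tT] eps eps0.
have [|d d0 Hd] := ff t _ eps eps0; first by rewrite t0 (le_trans tT).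
by exists d => // s /andP[s0 sT]; apply: Hd; rewrite s0 (le_trans sT).
Qed.

Lemma has_rderiv_cst T (x : R[i]) : has_rderiv T (fun=> x) (fun=> 0).
Proof.
move=> t _ eps eps0; exists 1 => // s _ _.
by rewrite subrr mulr0 subr0 cabs0 mulr_ge0// ltW.
Qed.

Lemma has_rderivD T f f' g g' : has_rderiv T f f' -> has_rderiv T g g' ->
  has_rderiv T (fun t => f t + g t) (fun t => f' t + g' t).
Proof.
move=> ff gg t tT eps eps0; have e2 : 0 < eps / 2 by rewrite divr_gt0.
have [d d0 Hd] := ff t tT _ e2; have [d' d'0 Hd'] := gg t tT _ e2.
exists (Num.min d d') => [|s sT]; first by rewrite lt_min d0.
rewrite lt_min => /andP[/(Hd _ sT) H /(Hd' _ sT) H'].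
have -> : f s + g s - (f t + g t) - (s - t)%:C * (f' t + g' t) =
  (f s - f t - (s - t)%:C * f' t) + (g s - g t - (s - t)%:C * g' t) by ring.
by apply: le_trans (cabsD _ _) _; lra.
Qed.

Lemma has_rderivZ T (x : R[i]) f f' : has_rderiv T f f' ->
  has_rderiv T (fun t => x * f t) (fun t => x * f' t).
Proof.
move=> ff t tT eps eps0; have x0 : 0 < cabs x + 1 by rewrite ltr_wpDl ?cabs_ge0.
have [d d0 Hd] := ff t tT _ (divr_gt0 eps0 x0).
exists d => // s sT /(Hd _ sT) H.
have -> : x * f s - x * f t - (s - t)%:C * (x * f' t) =
  x * (f s - f t - (s - t)%:C * f' t) by ring.
rewrite cabsM; apply: (@le_trans _ _ (cabs x * (eps / (cabs x + 1) * `|s - t|))).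
  by rewrite ler_wpM2l ?cabs_ge0.
rewrite mulrA ler_wpM2r// mulrA ler_pdivrMr// mulrC ler_wpM2l ?(ltW eps0)//.
by rewrite lerDl.
Qed.

Lemma has_rderiv_sum T (I : Type) (r : seq I) (f f' : I -> R -> R[i]) :
  (forall i, has_rderiv T (f i) (f' i)) ->
  has_rderiv T (fun t => \sum_(i <- r) f i t) (fun t => \sum_(i <- r) f' i t).
Proof.
move=> ff; elim: r => [|i r IH].
  have E0 (h : I -> R -> R[i]) : (fun t => \sum_(i <- [::]) h i t) = fun=> 0.
    by apply/funext => t; rewrite big_nil.
  by rewrite !E0; exact: has_rderiv_cst.
have E1 (h : I -> R -> R[i]) : (fun t => \sum_(k <- i :: r) h k t) =
    (fun t => h i t + \sum_(k <- r) h k t).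
  by apply/funext => t; rewrite big_cons.
by rewrite !E1; exact: has_rderivD.
Qed.

Lemma has_rderiv_lin T (x : R[i]) : has_rderiv T (fun t => t%:C * x) (fun=> x).
Proof.
move=> t _ eps eps0; exists 1 => // s _ _.
by rewrite rmorphB/= mulrBl subrr cabs0 mulr_ge0// ltW.
Qed.

(** A short interval is cut at the point where the derivative is taken, so that
    its increment is at most its length times a constant slightly above [C]. *)
Lemma mean_value T f f' (C : R) : 0 <= T -> has_rderiv T f f' ->
  (forall t, 0 <= t <= T -> cabs (f' t) <= C) -> cabs (f T - f 0) <= C * T.
Proof.
move=> T0 ff fC; apply/ler_addgt0Pr => e e0.
have e1 : 0 < e / (T + 1) by rewrite divr_gt0// ltr_wpDl.
suff : cabs (f T - f 0) <= (C + e / (T + 1)) * (T - 0).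
  move=> /le_trans; apply; rewrite subr0 mulrDl lerD2l.
  by rewrite -mulrA ger_pMr// mulrC ler_pdivrMr ?mul1r ?lerDl// ltr_wpDl.
apply: (@cousin (fun a b => cabs (f b - f a) <= (C + e / (T + 1)) * (b - a))) => //.
  move=> a c b ac cb Ha Hb; have -> : f b - f a = (f b - f c) + (f c - f a) by ring.
  by apply: le_trans (cabsD _ _) _; lra.
move=> t tT; have [d d0 Hd] := ff t tT _ e1; exists d => // a b a0 at_ tb bT ba.
have /andP[t0 tT'] := tT.
have step s : 0 <= s <= T -> `|s - t| < d ->
    cabs (f s - f t) <= (C + e / (T + 1)) * `|s - t|.
  move=> sT sd; have := Hd s sT sd.
  have := cabs_le_dist (f s - f t) ((s - t)%:C * f' t).
  rewrite cabsM cabs_real; have := fC t tT.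
  have : 0 <= `|s - t| by []; nra.
have Hb : cabs (f b - f t) <= (C + e / (T + 1)) * (b - t).
  rewrite -[X in _ * X]ger0_norm ?subr_ge0//.
  by apply: step; rewrite ?ger0_norm ?subr_ge0//; lra.
have Ha : cabs (f a - f t) <= (C + e / (T + 1)) * (t - a).
  rewrite -[X in _ * X]ger0_norm ?subr_ge0// distrC.
  by apply: step; rewrite 1?distrC ?ger0_norm ?subr_ge0//; lra.
have -> : f b - f a = (f b - f t) - (f a - f t) by ring.
by apply: le_trans (cabsB _ _) _; lra.
Qed.

Lemma has_rderiv_bounded T f f' : 0 <= T -> has_rderiv T f f' ->
  exists M, forall t, 0 <= t <= T -> cabs (f t) <= M.
Proof.
move=> T0 ff.
apply: (@cousin (fun a b => exists M, forall t, a <= t <= b -> cabs (f t) <= M)) => //.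
  move=> a c b ac cb [M HM] [N HN]; exists (Num.max M N) => t /andP[at_ tb].
  rewrite le_max; have [tc|/ltW ct] := leP t c.
    by rewrite HM// at_.
  by rewrite HN ?orbT// ct.
move=> t tT; have [d d0 Hd] := ff t tT _ ltr01; exists d => // a b a0 at_ tb bT ba.
exists (cabs (f t) + d * (1 + cabs (f' t))) => s /andP[as_ sb].
have sT : 0 <= s <= T by lra.
have sd : `|s - t| < d by rewrite ltr_norml; lra.
have := Hd s sT sd; have := cabs_le_dist (f s - f t) ((s - t)%:C * f' t).
have := cabs_le_dist (f s) (f t); rewrite cabsM cabs_real.
have := cabs_ge0 (f' t); have : 0 <= `|s - t| by [].
by nra.
Qed.

(** A Gronwall estimate with the constant made so small that one application of
    the mean value inequality to the supremum over the path suffices. *)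
Lemma family_growth (I : finType) (P : pred I) (f f' : I -> R -> R[i]) (A : R) :
  0 <= A ->
  (forall i, P i -> has_rderiv 1 (f i) (f' i)) ->
  (forall i, P i -> cabs (f i 0) <= A) ->
  (forall t (B : R), 0 <= t <= 1 -> (forall i, P i -> cabs (f i t) <= B) ->
     forall i, P i -> cabs (f' i t) <= B / 2) ->
  forall i, P i -> cabs (f i 1) <= A * 2.
Proof.
move=> A0 ff fA fB i Pi.
have [M HM] : exists M, forall k t, P k -> 0 <= t <= 1 -> cabs (f k t) <= M.
  have /choice[M HM] : forall k, exists M, P k -> forall t,
      0 <= t <= 1 -> cabs (f k t) <= M.
    move=> k; have [Pk|] := boolP (P k); last by exists 0.
    by have [M HM] := has_rderiv_bounded ler01 (ff k Pk); exists M.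
  exists (\big[Num.max/0]_k M k) => k t Pk tT.
  by apply: le_trans (HM _ Pk _ tT) _; exact: le_bigmax.
pose E := [set cabs (f p.1 p.2) | p in [set p : I * R | P p.1 /\ 0 <= p.2 <= 1]].
have Ei : E (cabs (f i 1)) by exists (i, 1) => //=; split=> //; rewrite ler01 lexx.
have hsE : has_sup E.
  split; first by exists (cabs (f i 1)).
  by exists M => _ [[k t]/= [Pk tT] <-]; exact: HM.
have Eub k t : P k -> 0 <= t <= 1 -> cabs (f k t) <= sup E.
  by move=> Pk tT; apply: sup_upper_bound => //; exists (k, t).
have E0 : 0 <= sup E by apply: le_trans (Eub i 1 Pi _); rewrite ?cabs_ge0 ?ler01 ?lexx.
have : sup E <= A + sup E / 2.
  apply: ge_sup; first by exists (cabs (f i 1)).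
  move=> _ [[k t]/= [Pk /andP[t0 t1]] <-].
  have := @mean_value t (f k) (f' k) (sup E / 2) t0 (has_rderiv_le t1 (ff k Pk)).
  have H s : 0 <= s <= t -> cabs (f' k s) <= sup E / 2.
    move=> /andP[s0 st]; have s1 : 0 <= s <= 1 by rewrite s0 (le_trans st).
    by apply: (fB s (sup E) s1) => // l Pl; exact: Eub.
  move=> /(_ H); have := fA k Pk; have := cabs_le_dist (f k t) (f k 0); nra.
have i1 : 0 <= (1 : R) <= 1 by rewrite ler01 lexx.
by have := Eub i 1 Pi i1; lra.
Qed.

(** The disc lies in a square, and the compactness of a segment is used in one
    coordinate after the other. *)
Lemma disc_bounded (g : R[i] -> R[i]) (r : R) : 0 <= r ->
  (forall w, cabs w <= r -> exists d M : R, 0 < d /\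
     forall v, cabs (v - w) < d -> cabs (g v) <= M) ->
  exists M : R, forall w, cabs w <= r -> cabs (g w) <= M.
Proof.
move=> r0 gloc; pose pt (x y : R) : R[i] := (x - r) +i* (y - r).
have T0 : 0 <= 2 * r by rewrite mulr_ge0.
pose bnd M w := cabs w <= r -> cabs (g w) <= M.
have bndW M N w : M <= N -> bnd M w -> bnd N w.
  by move=> MN H /H /le_trans; apply.
suff [M HM] : exists M, forall x, 0 <= x <= 2 * r -> forall y, 0 <= y <= 2 * r ->
    bnd M (pt x y).
  exists M => w wr; have := cabs_Re w; have := cabs_Im w.
  case: w wr => x y wr /= Hy Hx.
  have -> : x +i* y = pt (x + r) (y + r) by rewrite /pt !addrK.
  move: (le_trans Hx wr) (le_trans Hy wr); rewrite !ler_norml => /andP[? ?] /andP[? ?].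
  by apply: HM; rewrite /pt ?addrK//; lra.
apply: (@cousin (fun a b => exists M, forall x, a <= x <= b ->
    forall y, 0 <= y <= 2 * r -> bnd M (pt x y))) => //.
  move=> a c b ac cb [M HM] [N HN]; exists (Num.max M N) => x /andP[ax xb] y yr.
  have [xc|/ltW cx] := leP x c.
    by apply: bndW (HM x _ y yr); rewrite ?le_max ?lexx// ax.
  by apply: bndW (HN x _ y yr); rewrite ?le_max ?lexx ?orbT// cx.
move=> x0 x0r.
have [d [M [d0 HM]]] : exists d M : R, 0 < d /\ forall x, `|x - x0| < d ->
    forall y, 0 <= y <= 2 * r -> bnd M (pt x y).
  apply: (@cousin (fun a b => exists d M : R, 0 < d /\ forall x, `|x - x0| < d ->
    forall y, a <= y <= b -> bnd M (pt x y))) => //.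
    move=> a c b ac cb [d [M [d0 HM]]] [d' [N [d'0 HN]]].
    exists (Num.min d d'), (Num.max M N); split; first by rewrite lt_min d0.
    move=> x; rewrite lt_min => /andP[xd xd'] y /andP[ay yb].
    have [yc|/ltW cy] := leP y c.
      by apply: bndW (HM x xd y _); rewrite ?le_max ?lexx// ay.
    by apply: bndW (HN x xd' y _); rewrite ?le_max ?lexx ?orbT// cy.
  move=> y0 y0r.
  have [d [M [d0 HM]]] : exists d M : R, 0 < d /\
      forall v, cabs (v - pt x0 y0) < d -> bnd M v.
    have [wr|wr] := leP (cabs (pt x0 y0)) r.
      have [d [M [d0 HM]]] := gloc _ wr; exists d, M; split=> // v /HM H _ //.
    exists (cabs (pt x0 y0) - r), 0; split; first by rewrite subr_gt0.
    move=> v vd vr; have := cabs_le_dist (pt x0 y0) v; rewrite cabsBC; lra.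
  exists (d / 2) => [|a b a0 ay0 y0b br ba]; first by rewrite divr_gt0.
  exists (d / 2), M; split=> [|x xd y /andP[ay yb]]; first by rewrite divr_gt0.
  apply: HM; have -> : pt x y - pt x0 y0 = (x - x0) +i* (y - y0).
    by apply/eqP; rewrite eq_complex /=; apply/andP; split; apply/eqP; ring.
  apply: le_lt_trans (le_cabs_cpx _ _) _.
  have : `|y - y0| < d / 2 by rewrite ltr_norml; lra.
  by lra.
exists d => // a b a0 ax0 x0b br ba; exists M => x /andP[ax xb].
by apply: HM; rewrite ltr_norml; lra.
Qed.

End RealVariable.

Lemma has_rderiv_monomial (R : realType) (T : R) (x : R[i]) m :
  has_rderiv T (fun t => (t ^+ m.+1 / (m.+1)`!%:R)%:C * x)
               (fun t => (t ^+ m / m`!%:R)%:C * x).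
Proof.
have H : has_rderiv T (fun t => t%:C ^+ m.+1) (fun t => m.+1%:R * t%:C ^+ m).
  move=> t _ eps eps0; have p0 : 0 < (`|t| + 1) ^+ m.+1 by rewrite exprn_gt0// ltr_wpDl.
  exists (Num.min 1 (eps / (`|t| + 1) ^+ m.+1)) => [|s _].
    by rewrite lt_min ltr01 divr_gt0.
  rewrite lt_min ltr_pdivlMr// => /andP[s1 se].
  have := @binomial_remainder R t%:C (s - t)%:C 1 m.+1 ltr01.
  rewrite !cabs_real => /(_ (ltW s1)); rewrite expr1n mulr1.
  rewrite -rmorphD/= [t + _]addrC subrK.
  rewrite [m.+1%:R * _]mulrC -mulrA => /le_trans; apply.
  by rewrite expr2 -mulrA mulrC ler_wpM2r// ltW.
have := has_rderivZ ((m.+1)`!%:R^-1 * x) H; congr has_rderiv; apply/funext => t.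
  by rewrite rmorphM rmorphXn/= fmorphV rmorph_nat; ring.
rewrite rmorphM rmorphXn/= fmorphV rmorph_nat factS natrM.
have : (m.+1%:R : R[i]) != 0 by rewrite pnatr_eq0.
have : (m`!%:R : R[i]) != 0 by rewrite pnatr_eq0 -lt0n fact_gt0.
by move=> *; field; apply/andP.
Qed.

(** Subtracting the monomial makes all initial values vanish, and the mean value
    inequality then brings the bound down from [f k] to [f 0] step by step. *)
Lemma taylor_chain (R : realType) (T eps : R) (x : R[i]) k (f : nat -> R -> R[i]) :
  0 <= eps -> (forall i, has_rderiv T (f i) (f i.+1)) ->
  (forall i, (i < k)%N -> f i 0 = 0) ->
  (forall t, 0 <= t <= T -> cabs (f k t - x) <= eps) ->
  forall t, 0 <= t <= T -> cabs (f 0 t - (t ^+ k / k`!%:R)%:C * x) <= eps * T ^+ k.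
Proof.
move=> eps0; elim: k f => [|k IH] f ff f0 fk t tT.
  by rewrite !expr0 fact0 divr1 mul1r mulr1 fk.
have {}IH s : 0 <= s <= T ->
    cabs (f 1%N s - (s ^+ k / k`!%:R)%:C * x) <= eps * T ^+ k.
  by apply: (IH (fun i => f i.+1)) => // i ik; exact: f0.
have /andP[t0 tT'] := tT.
have := has_rderivD (ff 0%N) (has_rderivZ (-1) (@has_rderiv_monomial R T x k)).
move=> /(has_rderiv_le tT')/(mean_value t0) => /(_ (eps * T ^+ k)).
rewrite f0// expr0n mul0r (_ : 0%:C = 0)// mul0r mulr0 addr0 subr0 mulN1r => H.
apply: le_trans (H _) _ => [s /andP[s0 st]|].
  by rewrite mulN1r; apply: IH; rewrite s0 (le_trans st).
rewrite exprSr mulrA ler_wpM2l// mulr_ge0// exprn_ge0//.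
exact: le_trans tT'.
Qed.

(** * Roots of unity *)

Section RootsOfUnity.
Variable R : realType.

Definition expi (x : R) : R[i] := cos x +i* sin x.

Lemma expiD x y : expi (x + y) = expi x * expi y.
Proof.
rewrite /expi cosD sinD; apply/eqP; rewrite eq_complex /=.
by rewrite eqxx/= addrC.
Qed.

Lemma expi0 : expi 0 = 1. Proof. by rewrite /expi cos0 sin0. Qed.

Lemma expiX x k : expi x ^+ k = expi (k%:R * x).
Proof.
elim: k => [|k IH]; first by rewrite expr0 mul0r expi0.
by rewrite exprS IH -expiD -natr1 mulrDl mul1r addrC.
Qed.

Lemma cabs_expi x : cabs (expi x) = 1.
Proof. by rewrite /cabs/= cos2Dsin2 sqrtr1. Qed.

Lemma expi_neq1 x : 0 < x < 2 * pi -> expi x != 1.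
Proof.
move=> /andP[x0 xpi]; rewrite eq_complex /= negb_and; apply/orP; left.
have s0 : 0 < sin (x / 2).
  by apply: sin_gt0_pi; rewrite divr_gt0//= ltr_pdivrMr// mulrC.
have -> : x = x / 2 + x / 2 by rewrite -splitr.
rewrite cosD -!expr2 cos2sin2.
by apply/negP => /eqP; have := exprn_gt0 2 s0; lra.
Qed.

(** Closeness to [1] makes Riemann sums over the powers accurate; primitivity
    makes the averages separate the Fourier coefficients below [N]. *)
Lemma unity_root_near1 (eps : R) k : 0 < eps -> exists (N : nat) (zeta : R[i]),
  [/\ (k < N)%N, zeta ^+ N = 1, cabs zeta = 1, cabs (zeta - 1) < eps &
    forall m, (0 < m < N)%N -> zeta ^+ m != 1].
Proof.
move=> eps0; have e2 : 0 < eps / 2 by rewrite divr_gt0.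
have expi1 x : cabs (expi x - 1) <= `|cos x - 1| + `|sin x|.
  have -> : expi x - 1 = (cos x - 1) +i* sin x.
    by apply/eqP; rewrite eq_complex /= !subr0 !eqxx.
  exact: le_cabs_cpx.
have [d d0 Hd] : exists2 d : R, 0 < d & forall x, `|x| < d -> cabs (expi x - 1) < eps.
  have /cvgrPdist_lt /(_ _ e2) Hc := @continuous_cos R 0.
  have /cvgrPdist_lt /(_ _ e2) Hs := @continuous_sin R 0.
  have /nbhs_ballP[d /= d0 Hd] : \forall x \near (0 : R),
      `|cos 0 - cos x| < eps / 2 /\ `|sin 0 - sin x| < eps / 2.
    by near=> x; split; near: x.
  exists d => // x xd.
  have [] : `|cos 0 - cos x| < eps / 2 /\ `|sin 0 - sin x| < eps / 2.
    by apply: Hd; rewrite /ball/= sub0r normrN.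
  rewrite cos0 sin0 sub0r normrN distrC => H1 H2.
  by apply: le_lt_trans (expi1 x) _; lra.
have [m Hm] : exists m : nat, 2 * pi / d < m%:R.
  by exists (Num.truncn (2 * pi / d)).+1; exact: truncnS_gt.
pose N := (k + m).+1; have N0 : 0 < N%:R :> R by rewrite ltr0n.
have p0 : 0 < 2 * (pi : R) by rewrite mulr_gt0 ?pi_gt0.
exists N, (expi (2 * pi / N%:R)); split.
- by rewrite ltnS leq_addr.
- by rewrite expiX mulrC divfK ?gt_eqF// mulr_natl /expi cos2pi sin2pi.
- exact: cabs_expi.
- apply: Hd; rewrite gtr0_norm ?divr_gt0// ltr_pdivrMr// -ltr_pdivrMl// mulrC.
  by apply: lt_le_trans Hm _; rewrite ler_nat ltnW// ltnS leq_addl.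
move=> l /andP[l0 lN]; rewrite expiX; apply: expi_neq1; apply/andP; split.
  by rewrite mulr_gt0 ?ltr0n// divr_gt0.
by rewrite mulrCA gtr_pMr// ltr_pdivrMr// mul1r ltr_nat.
Unshelve. all: by end_near.
Qed.

Lemma sum_unity_root (N : nat) (q : R[i]) : q ^+ N = 1 -> q != 1 ->
  \sum_(j < N) q ^+ j = 0.
Proof.
move=> qN q1; have := subrX1 q N; rewrite qN subrr => /esym/eqP.
by rewrite mulf_eq0 subr_eq0 (negbTE q1) => /eqP.
Qed.

End RootsOfUnity.

(** * Cauchy's estimate on a disc *)

(** [g 0] is holomorphic around the closed disc of radius [r], with successive
    derivatives [g 1], [g 2], and so on. *)
Definition derivative_chain (R : realType) (r : R) (g : nat -> R[i] -> R[i]) :=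
  forall i w, cabs w <= r ->
  forall eps : R, 0 < eps -> exists2 d : R, 0 < d & forall h, cabs h < d ->
    cabs (g i (w + h) - g i w - h * g i.+1 w) <= eps * cabs h.

Section CauchyDisc.
Variables (R : realType) (r : R) (g : nat -> R[i] -> R[i]).
Hypothesis r_gt0 : 0 < r.
Hypothesis gchain : derivative_chain r g.

Lemma segment_rderiv T i w v :
  (forall t, 0 <= t <= T -> cabs (w + t%:C * v) <= r) ->
  has_rderiv T (fun t => g i (w + t%:C * v)) (fun t => v * g i.+1 (w + t%:C * v)).
Proof.
move=> Hdisc t tT eps eps0; have v0 : 0 < cabs v + 1 by rewrite ltr_wpDl ?cabs_ge0.
have [d d0 Hd] := gchain i (Hdisc t tT) (divr_gt0 eps0 v0).
exists (d / (cabs v + 1)) => [|s sT]; first by rewrite divr_gt0.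
rewrite ltr_pdivlMr// => std.
have := Hd ((s - t)%:C * v).
have -> : w + t%:C * v + (s - t)%:C * v = w + s%:C * v by rewrite rmorphB/=; ring.
rewrite -(mulrA _ v) cabsM cabs_real => H; apply: le_trans (H _) _.
  by apply: le_lt_trans std; rewrite ler_wpM2l// lerDl.
have -> : eps / (cabs v + 1) * (`|s - t| * cabs v) =
  (eps * `|s - t|) * (cabs v / (cabs v + 1)) by ring.
by rewrite ler_piMr ?mulr_ge0 ?(ltW eps0)// ler_pdivrMr// mul1r lerDl.
Qed.

Lemma chain_bounded i :
  exists2 C : R, 0 <= C & forall w, cabs w <= r -> cabs (g i w) <= C.
Proof.
have [|M HM] := @disc_bounded R (g i) r (ltW r_gt0).
  move=> w wr; have [d d0 Hd] := gchain i wr ltr01.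
  exists d, (cabs (g i w) + d * (1 + cabs (g i.+1 w))); split=> // v vd.
  have := Hd (v - w) vd; rewrite (addrC w) subrK mul1r.
  have := cabs_le_dist (g i v) (g i w).
  have := cabs_le_dist (g i v - g i w) ((v - w) * g i.+1 w); rewrite cabsM.
  by have := cabs_ge0 (g i.+1 w); have := cabs_ge0 (v - w); nra.
have r0 : cabs (0 : R[i]) <= r by rewrite cabs0 ltW.
by exists M => //; exact: (le_trans (cabs_ge0 (g i 0)) (HM 0 r0)).
Qed.

Lemma taylor_order2 i w v C : cabs w <= r -> cabs (w + v) <= r ->
  (forall u, cabs u <= r -> cabs (g i.+2 u) <= C) ->
  cabs (g i (w + v) - g i w - v * g i.+1 w) <= C * cabs v ^+ 2.
Proof.
move=> wr wvr HC.
have seg t : 0 <= t <= 1 -> cabs (w + t%:C * v) <= r.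
  move=> /andP[t0 t1]; have -> : w + t%:C * v = (1 - t)%:C * w + t%:C * (w + v).
    by rewrite rmorphB rmorph1; ring.
  apply: le_trans (cabsD _ _) _; rewrite !cabsM !cabs_real !ger0_norm ?subr_ge0//.
  by nra.
have C0 : 0 <= C by apply: le_trans (cabs_ge0 _) (HC _ wr).
have H1 t : 0 <= t <= 1 -> cabs (g i.+1 (w + t%:C * v) - g i.+1 w) <= C * cabs v.
  move=> /andP[t0 t1].
  have seg' s : 0 <= s <= t -> cabs (w + s%:C * v) <= r.
    by move=> /andP[s0 st]; apply: seg; rewrite s0 (le_trans st).
  have := mean_value t0 (segment_rderiv i.+1 seg') (C := cabs v * C).
  rewrite (_ : 0%:C = 0)// mul0r addr0 => H; apply: le_trans (H _) _.
    by move=> s /seg'/HC; rewrite cabsM => Hs; rewrite ler_wpM2l ?cabs_ge0.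
  by rewrite mulrC (mulrC C) ler_piMl// mulr_ge0 ?cabs_ge0.
have Hd := has_rderivD (segment_rderiv i seg) (@has_rderiv_lin R 1 (- (v * g i.+1 w))).
have := mean_value ler01 Hd (C := C * cabs v ^+ 2).
rewrite (_ : 0%:C = 0)// (_ : 1%:C = 1)// !mul0r !mul1r !addr0 mulr1 => H.
have -> : g i (w + v) - g i w - v * g i.+1 w =
  g i (w + v) - v * g i.+1 w - g i w by ring.
apply: H => t t1; rewrite -mulrBr cabsM expr2 mulrA [leRHS]mulrC.
by rewrite ler_wpM2l ?cabs_ge0 ?H1.
Qed.

Lemma cabs_average (N : nat) (f : nat -> R[i]) (M : R) : 0 <= M ->
  (forall j, cabs (f j) <= M) -> cabs (N%:R^-1 * \sum_(j < N) f j) <= M.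
Proof.
move=> M0 fM; rewrite cabsM cabsV cabs_nat.
have [->|N0] := posnP N; first by rewrite invr0 mul0r.
rewrite ler_pdivrMl ?ltr0n//; apply: le_trans (cabs_sum _ _ _) _.
apply: le_trans (_ : \sum_(j < N) M <= _); first exact: ler_sum.
by rewrite sumr_const card_ord mulr_natl.
Qed.

Section Averages.
Variables (N : nat) (zeta : R[i]).
Hypotheses (zetaN : zeta ^+ N = 1) (czeta : cabs zeta = 1).
Hypothesis zeta_prim : forall m, (0 < m < N)%N -> zeta ^+ m != 1.
Hypothesis N_gt1 : (1 < N)%N.

Let czetaX j : cabs (zeta ^+ j) = 1. Proof. by rewrite cabsX czeta expr1n. Qed.

Let on_circle t j : 0 <= t <= r -> cabs (t%:C * zeta ^+ j) <= r.
Proof. by move=> /andP[t0 tr]; rewrite cabsM czetaX mulr1 cabs_real ger0_norm. Qed.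

Let ray j t : 0 <= t <= r -> cabs (0 + t%:C * zeta ^+ j) <= r.
Proof. by move=> tr; rewrite add0r on_circle. Qed.

Let zeta_neq1 : zeta != 1.
Proof. by have := zeta_prim (m := 1); rewrite expr1 N_gt1; apply. Qed.

(** The radial derivative of the average is a Riemann sum of the integral of
    [g i.+1] over the circle; the increments of the primitive [g i] telescope to
    zero, so only the error of order two remains. *)
Lemma average_deriv_small i C t : 0 <= t <= r -> 0 <= C ->
  (forall u, cabs u <= r -> cabs (g i.+2 u) <= C) ->
  cabs (N%:R^-1 * \sum_(j < N) zeta ^+ j * g i.+1 (t%:C * zeta ^+ j))
    <= C * r * cabs (zeta - 1).
Proof.
move=> tr C0 HC; have /andP[t0 tr'] := tr.
have z0 : 0 < cabs (zeta - 1).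
  rewrite lt_def cabs_ge0 andbT; apply: contra zeta_neq1 => /eqP/cabs_eq0/eqP.
  by rewrite subr_eq0.
(* at the centre all terms share the factor [g i.+1 0], and the roots sum to [0] *)
have [t_eq0|tneq0] := eqVneq t 0.
  rewrite t_eq0 (_ : 0%:C = 0)//; under eq_bigr do rewrite mul0r.
  rewrite -mulr_suml sum_unity_root// mul0r mulr0 cabs0.
  by rewrite !mulr_ge0 ?(ltW r_gt0) ?cabs_ge0.
have {}t0 : 0 < t by rewrite lt_def tneq0.
pose E j := g i (t%:C * zeta ^+ j.+1) - g i (t%:C * zeta ^+ j)
  - t%:C * (zeta - 1) * (zeta ^+ j * g i.+1 (t%:C * zeta ^+ j)).
have EC j : cabs (E j) <= C * (t * cabs (zeta - 1)) ^+ 2.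
  pose v := t%:C * (zeta - 1) * zeta ^+ j.
  have vE : t%:C * zeta ^+ j + v = t%:C * zeta ^+ j.+1 by rewrite /v exprS; ring.
  have := @taylor_order2 i (t%:C * zeta ^+ j) v C (on_circle j tr) _ HC.
  rewrite vE => /(_ (on_circle j.+1 tr)).
  by rewrite /v /E !cabsM czetaX mulr1 cabs_real gtr0_norm// -!mulrA.
have ES : t%:C * (zeta - 1) *
    (N%:R^-1 * \sum_(j < N) zeta ^+ j * g i.+1 (t%:C * zeta ^+ j)) =
    - (N%:R^-1 * \sum_(j < N) E j).
  have : \sum_(j < N) (g i (t%:C * zeta ^+ j.+1) - g i (t%:C * zeta ^+ j)) = 0.
    rewrite -(big_mkord xpredT (fun j =>
      g i (t%:C * zeta ^+ j.+1) - g i (t%:C * zeta ^+ j))).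
    rewrite (telescope_sumr (fun j => g i (t%:C * zeta ^+ j)))//.
    by rewrite zetaN expr0 subrr.
  rewrite /E => H; rewrite [X in _ = - (_ * X)]sumrB H -mulr_sumr; ring.
have := @cabs_average N E (C * (t * cabs (zeta - 1)) ^+ 2) _ EC.
rewrite -(cabsN (N%:R^-1 * _)) -ES !cabsM cabs_real gtr0_norm// => H.
have tz : 0 < t * cabs (zeta - 1) by rewrite mulr_gt0.
rewrite -(ler_pM2l tz); apply: le_trans (H _) _.
  by rewrite mulr_ge0// exprn_ge0// ltW.
rewrite expr2 mulrCA ler_pM2l//.
by rewrite mulrA ler_wpM2r ?cabs_ge0// ler_wpM2l.
Qed.

Lemma average_near_center i C t : 0 <= t <= r -> 0 <= C ->
  (forall u, cabs u <= r -> cabs (g i.+2 u) <= C) ->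
  cabs (N%:R^-1 * \sum_(j < N) g i (t%:C * zeta ^+ j) - g i 0)
    <= C * r * cabs (zeta - 1) * r.
Proof.
move=> /andP[t0 tr] C0 HC.
have Hd := has_rderivZ (N%:R^-1) (has_rderiv_sum (index_enum 'I_N)
  (fun j : 'I_N => segment_rderiv i (ray j))).
have := mean_value t0 (has_rderiv_le tr Hd) (C := C * r * cabs (zeta - 1)).
have -> : N%:R^-1 * (\sum_(j < N) g i (0 + 0%:C * zeta ^+ j)) = g i 0.
  rewrite (_ : 0%:C = 0)//; under eq_bigr do rewrite mul0r addr0.
  rewrite sumr_const card_ord -[g i 0 *+ _]mulr_natl mulrA mulVf ?mul1r//.
  by rewrite pnatr_eq0 -lt0n (ltn_trans _ N_gt1).
under eq_bigr do rewrite add0r.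
move=> H; apply: le_trans (H _) _.
  move=> s /andP[s0 st]; under eq_bigr do rewrite add0r.
  by apply: average_deriv_small => //; rewrite s0 (le_trans st).
by rewrite ler_wpM2l// !mulr_ge0 ?cabs_ge0// ltW.
Qed.

(** The [k]-th Fourier coefficient of [g 0] on circles is compared with its
    Taylor polynomial in the radius: it vanishes to order [k] at the centre and
    its [k]-th derivative is the average of [g k]. *)
Lemma fourier_coef_approx k C : (k < N)%N -> 0 <= C ->
  (forall u, cabs u <= r -> cabs (g k.+2 u) <= C) ->
  cabs (N%:R^-1 * \sum_(j < N) zeta^-1 ^+ (j * k) * g 0%N (r%:C * zeta ^+ j)
      - (r ^+ k / k`!%:R)%:C * g k 0)
    <= C * r * cabs (zeta - 1) * r * r ^+ k.
Proof.
move=> kN C0 HC.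
have z0 : zeta != 0.
  apply/eqP => z0; move: czeta; rewrite z0 cabs0 => /esym/eqP.
  by rewrite oner_eq0.
pose B i t := N%:R^-1 * \sum_(j < N)
   (zeta^-1 ^+ (j * k) * zeta ^+ (j * i)) * g i (0 + t%:C * zeta ^+ j).
have rr : 0 <= r <= r by rewrite lexx ltW.
have <- : B 0%N r =
    N%:R^-1 * \sum_(j < N) zeta^-1 ^+ (j * k) * g 0%N (r%:C * zeta ^+ j).
  by congr (_ * _); apply: eq_bigr => j _; rewrite muln0 expr0 mulr1 add0r.
apply: taylor_chain rr.
- by rewrite !mulr_ge0 ?cabs_ge0// ltW.
- move=> i; have := has_rderivZ (N%:R^-1) (has_rderiv_sum (index_enum 'I_N)
    (fun j : 'I_N => has_rderivZ (zeta^-1 ^+ (j * k) * zeta ^+ (j * i))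
                       (segment_rderiv i (ray j)))).
  congr has_rderiv; apply/funext => t; congr (_ * _); apply: eq_bigr => j _.
  by rewrite mulnS exprD; ring.
- move=> i ik; rewrite /B (_ : 0%:C = 0)//; under eq_bigr do rewrite mul0r addr0.
  have kiN : (0 < k - i < N)%N by rewrite subn_gt0 ik (leq_ltn_trans (leq_subr _ _)).
  rewrite -mulr_suml (eq_bigr (fun j : 'I_N => (zeta^-1 ^+ (k - i)) ^+ j)).
    rewrite sum_unity_root ?mul0r ?mulr0//.
      by rewrite -exprM mulnC exprM exprVn zetaN invr1 expr1n.
    by rewrite exprVn invr_eq1 zeta_prim.
  move=> j _; rewrite -exprM mulnC -[in LHS](subnK (ltnW ik)) mulnDl exprD -mulrA.
  by rewrite [(j * i)%N]mulnC -exprMn mulVf// expr1n mulr1.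
- move=> t tr; have := average_near_center tr C0 HC.
  rewrite /B; under [X in _ -> cabs (_ * X - _) <= _]eq_bigr do
    rewrite exprVn mulVf ?expf_neq0// mul1r add0r.
  by [].
Qed.

End Averages.

(** The Fourier coefficient is bounded by [M], being an average, and the error in
    [fourier_coef_approx] vanishes as the root tends to [1]. *)
Lemma cauchy_disc k M : (forall w, cabs w <= r -> cabs (g 0%N w) <= M) ->
  cabs (g k 0) * r ^+ k <= k`!%:R * M.
Proof.
move=> gM; have [C C0 HC] := chain_bounded k.+2.
have M0 : 0 <= M by apply: le_trans (cabs_ge0 _) (gM 0 _); rewrite cabs0 ltW.
have kf : 0 < k`!%:R :> R by rewrite ltr0n fact_gt0.
rewrite -ler_pdivrMl//; apply/ler_addgt0Pr => e e0.
pose D := C * r * r * r ^+ k + 1.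
have D0 : 0 < D by rewrite ltr_wpDl// !mulr_ge0 ?exprn_ge0// ltW.
have [N [zeta [kN zN cz z1 zprim]]] := unity_root_near1 k.+1 (divr_gt0 e0 D0).
have N1 : (1 < N)%N by rewrite (leq_ltn_trans _ kN).
have := fourier_coef_approx zN cz zprim N1 (ltnW kN) C0 HC.
rewrite ltr_pdivlMr// in z1.
set S := N%:R^-1 * _; set P := _%:C * _ => SP.
have SM : cabs S <= M.
  apply: (@cabs_average N (fun j =>
    zeta^-1 ^+ (j * k) * g 0%N (r%:C * zeta ^+ j))) => // j.
  rewrite cabsM cabsX cabsV cz invr1 expr1n mul1r gM//.
  by rewrite cabsM cabsX cz expr1n mulr1 cabs_real gtr0_norm.
have PE : cabs P = k`!%:R^-1 * (cabs (g k 0) * r ^+ k).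
  rewrite cabsM cabs_real ger0_norm; first by ring.
  by rewrite divr_ge0// ?exprn_ge0// ltW.
rewrite -PE; have := cabs_le_dist P S; rewrite cabsBC.
have : C * r * cabs (zeta - 1) * r * r ^+ k <= cabs (zeta - 1) * D.
  have -> : C * r * cabs (zeta - 1) * r * r ^+ k =
    cabs (zeta - 1) * (C * r * r * r ^+ k) by ring.
  by rewrite ler_wpM2l ?cabs_ge0// lerDl.
by lra.
Qed.

End CauchyDisc.

(** * Cauchy's estimate on a polydisc *)

Section CommutingIterates.
Variables (T I : eqType) (D : I -> T -> T).
Hypothesis DC : forall i j x, D i (D j x) = D j (D i x).

Lemma iter_commute i j k x : D j (iter k (D i) x) = iter k (D i) (D j x).
Proof. by elim: k => //= k <-. Qed.

(** The extra application of [D j] migrates to the block of [j] in the list. *)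
Lemma foldr_iter_succ (K K' : I -> nat) (j : I) (s : seq I) x : uniq s -> j \in s ->
  (forall i, K' i = (K i + (i == j))%N) ->
  D j (foldr (fun i => iter (K i) (D i)) x s) = foldr (fun i => iter (K' i) (D i)) x s.
Proof.
move=> us js KK; elim: s us js => //= i s IH /andP[is_ us].
rewrite inE => /orP[/eqP ji|js].
  rewrite KK ji eqxx addn1 /=; congr (D _ (iter _ _ _)).
  elim: s is_ {us IH} => //= l s IH; rewrite inE negb_or => /andP[il ls].
  by rewrite IH// KK ji eq_sym (negbTE il) addn0.
have ij : i == j = false by apply: contraNF is_ => /eqP->.
by rewrite iter_commute IH// KK ij addn0.
Qed.

End CommutingIterates.

Section MultiCauchy.
Variables (R : realType) (n : nat).
Implicit Types (F G : 'rV[R[i]]_n -> R[i]) (a z : 'rV[R[i]]_n) (j : 'I_n).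
Implicit Types K : multiindex n.

Lemma deriv_coefC i j (c : multiindex n -> R[i]) :
  deriv_coef i (deriv_coef j c) = deriv_coef j (deriv_coef i c).
Proof.
apply/funext => K; rewrite /deriv_coef !ffunE mulrCA (eq_sym j i).
have -> : madd1 (madd1 K i) j = madd1 (madd1 K j) i.
  by apply/ffunP => l; rewrite !ffunE addnAC.
have [->|ij] := eqVneq i j; first by rewrite mulrCA.
by rewrite !addn0.
Qed.

Lemma psum_foldr F a c K s : psum_at F a c ->
  psum_at (foldr (fun j => iter (K j) (@partial_derive R n j)) F s) a
          (foldr (fun j => iter (K j) (@deriv_coef R n j)) c s).
Proof.
move=> Fc; elim: s => [|j s IH]; first exact: Fc.
rewrite /=; elim: (K j) => [|k IHk]; first exact: IH.
by rewrite !iterS; exact: psum_deriv IHk.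
Qed.

Lemma analytic_partial j F :
  analytic_on_ball F -> analytic_on_ball (partial_derive j F).
Proof.
move=> /analytic_psum HF; apply/analytic_psum => a /HF[c Hc].
by exists (deriv_coef j c); exact: psum_deriv.
Qed.

Lemma analytic_foldr F K s : analytic_on_ball F ->
  analytic_on_ball (foldr (fun j => iter (K j) (@partial_derive R n j)) F s).
Proof.
move=> HF; elim: s => [|j s IH]; first exact: HF.
rewrite /=; elim: (K j) => [|k IHk]; first exact: IH.
by rewrite iterS; exact: analytic_partial IHk.
Qed.

(** The partial derivatives commute because the corresponding operators on the
    coefficients do, and a power series is determined at its centre by its
    constant coefficient. *)
Lemma partial_mderive F K j a : analytic_on_ball F -> unit_ball R n a ->
  partial_derive j (mderive F K) a = mderive F (madd1 K j) a.
Proof.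
move=> /analytic_psum HF /HF[c Hc].
rewrite /mderive (psum_value (psum_deriv j (psum_foldr K (enum 'I_n) Hc))).
rewrite (psum_value (psum_foldr (madd1 K j) (enum 'I_n) Hc)).
congr (_ _); apply: (foldr_iter_succ deriv_coefC).
- exact: enum_uniq.
- by rewrite mem_enum.
- by move=> i; rewrite ffunE.
Qed.

Lemma analytic_cderiv F a j : analytic_on_ball F -> unit_ball R n a ->
  forall eps, 0 < eps -> exists2 d, 0 < d & forall h, cabs h < d ->
    cabs (F (a + h *: delta_mx 0 j) - F a - h * partial_derive j F a) <= eps * cabs h.
Proof. by move=> /analytic_psum HF /HF[c] /(psum_cderiv j). Qed.

Lemma cauchy_coordinate F z j (r M : R) k : analytic_on_ball F -> 0 < r ->
  (forall w, cabs w <= r -> unit_ball R n (z + w *: delta_mx 0 j)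
     /\ cabs (F (z + w *: delta_mx 0 j)) <= M) ->
  cabs (iter k (partial_derive j) F z) * r ^+ k <= k`!%:R * M.
Proof.
move=> HF r0 HM.
pose g i w := iter i (partial_derive j) F (z + w *: delta_mx 0 j).
have -> : iter k (partial_derive j) F z = g k 0 by rewrite /g scale0r addr0.
apply: (@cauchy_disc R r g r0); last by move=> w /HM[].
move=> i w /HM[wb _] eps eps0; rewrite /g.
have Hi : analytic_on_ball (iter i (partial_derive j) F).
  elim: i => [|i IHi]; first exact: HF.
    by rewrite iterS; exact: analytic_partial IHi.
have [d d0 Hd] := analytic_cderiv j Hi wb eps0; exists d => // h /Hd.
by rewrite scalerDl addrA.
Qed.

(** The coordinates outside [s] stay fixed, so that the estimate for the tail of
    the list is available at every point of the disc in the head coordinate. *)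
Lemma cauchy_iterated F K (rho : 'rV[R]_n) (M : R) s z : analytic_on_ball F ->
  (forall j, 0 < rho 0 j) -> uniq s ->
  (forall z', (forall i, i \in s -> cabs (z' 0 i - z 0 i) <= rho 0 i) ->
     (forall i, i \notin s -> z' 0 i = z 0 i) ->
     unit_ball R n z' /\ cabs (F z') <= M) ->
  cabs (foldr (fun j => iter (K j) (@partial_derive R n j)) F s z)
    * \prod_(j <- s) rho 0 j ^+ K j <= (\prod_(j <- s) (K j)`!)%N%:R * M.
Proof.
move=> HF rho0; elim: s z => [|j s IH] z /=.
  by move=> _ H; rewrite !big_nil mulr1 mul1r; have [] := H z.
move=> /andP[js us] H; rewrite !big_cons.
have P0 : 0 < \prod_(i <- s) rho 0 i ^+ K i.
  by apply: prodr_gt0 => i _; rewrite exprn_gt0.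
have shift w i : (z + w *: delta_mx 0 j) 0 i = z 0 i + w * (i == j)%:R.
  by rewrite !mxE eqxx.
have := @cauchy_coordinate (foldr (fun j => iter (K j) (@partial_derive R n j)) F s)
  z j (rho 0 j) ((\prod_(i <- s) (K i)`!)%N%:R * M / \prod_(i <- s) rho 0 i ^+ K i)
  (K j) (analytic_foldr K s HF) (rho0 j).
rewrite mulrA ler_pdivlMr// => Hj; rewrite mulrA natrM -[leRHS]mulrA; apply: Hj.
move=> w wr; split.
  have [] // := H (z + w *: delta_mx 0 j) => [i|i].
    rewrite shift inE addrC addKr.
    case: eqP => [->|_] _; rewrite ?mulr1// mulr0 cabs0 ltW//.
  by rewrite shift inE negb_or => /andP[/negbTE-> _]; rewrite mulr0 addr0.
rewrite ler_pdivlMr//; apply: IH => // z' Hz' Hz''; apply: H => i.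
  rewrite inE; have [->|ij] := eqVneq i j => /= [_|is_].
    by rewrite Hz''// shift eqxx mulr1 addrC addKr.
  by have := Hz' _ is_; rewrite shift (negbTE ij) mulr0 addr0.
by rewrite inE negb_or => /andP[/negbTE ij /Hz'']; rewrite shift ij mulr0 addr0.
Qed.

Lemma cauchy_polydisc F K (rho : 'rV[R]_n) (M : R) z : analytic_on_ball F ->
  (forall j, 0 < rho 0 j) -> polydisc z rho `<=` unit_ball R n ->
  (forall z', polydisc z rho z' -> cabs (F z') <= M) ->
  cabs (mderive F K z) * mpow rho K <= (mfact K)%:R * M.
Proof.
move=> HF rho0 sub HM.
have := @cauchy_iterated F K rho M (enum 'I_n) z HF rho0 (enum_uniq _).
rewrite !big_enum; apply=> z' Hz' _.
have zP : polydisc z rho z' by move=> j; apply: Hz'; rewrite mem_enum.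
by split; [exact: sub|exact: HM].
Qed.

End MultiCauchy.

(** * Euclidean norm, polydiscs and the ball *)

Section EuclideanNorm.
Variables (R : realType) (n : nat).
Implicit Types x y : 'rV[R]_n.

Lemma enorm_ge0 x : 0 <= enorm x. Proof. exact: sqrtr_ge0. Qed.

Lemma sqr_enorm x : enorm x ^+ 2 = \sum_j x 0 j ^+ 2.
Proof. by rewrite sqr_sqrtr// sumr_ge0// => j _; rewrite sqr_ge0. Qed.

Lemma le_enorm x y : (forall j, 0 <= x 0 j <= y 0 j) -> enorm x <= enorm y.
Proof.
move=> xy; apply: ler_wsqrtr; apply: ler_sum => j _; have /andP[x0 xyj] := xy j.
by rewrite lerXn2r// nnegrE// (le_trans x0).
Qed.

Lemma enormZ (a : R) x : 0 <= a -> enorm (a *: x) = a * enorm x.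
Proof.
move=> a0; rewrite /enorm; under eq_bigr do rewrite mxE exprMn.
by rewrite -mulr_sumr sqrtrM ?sqr_ge0// sqrtr_sqr ger0_norm.
Qed.

Lemma sum_mul_le_enorm x y : \sum_j x 0 j * y 0 j <= enorm x * enorm y.
Proof.
have key (a b : R) : 0 < a -> 0 < b -> enorm x <= a -> enorm y <= b ->
    \sum_j x 0 j * y 0 j <= a * b.
  move=> a0 b0 xa yb.
  have : \sum_j (b * x 0 j - a * y 0 j) ^+ 2 >= 0.
    by apply: sumr_ge0 => j _; exact: sqr_ge0.
  have -> : \sum_j (b * x 0 j - a * y 0 j) ^+ 2 = b ^+ 2 * enorm x ^+ 2
      + a ^+ 2 * enorm y ^+ 2 - 2 * (a * b) * (\sum_j x 0 j * y 0 j).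
    rewrite !sqr_enorm !mulr_sumr -big_split -sumrB; apply: eq_bigr => j _ /=; ring.
  have : enorm x ^+ 2 <= a ^+ 2 by rewrite lerXn2r// ?nnegrE ?enorm_ge0 ?ltW.
  have : enorm y ^+ 2 <= b ^+ 2 by rewrite lerXn2r// ?nnegrE ?enorm_ge0 ?ltW.
  have a2 : 0 < a ^+ 2 by rewrite exprn_gt0.
  have b2 : 0 < b ^+ 2 by rewrite exprn_gt0.
  move=> /(ler_wpM2l (ltW a2)) H1 /(ler_wpM2l (ltW b2)) H2 H3.
  have ab : 0 < 2 * (a * b) by rewrite !mulr_gt0.
  rewrite -(ler_pM2l ab).
  have -> : 2 * (a * b) * (a * b) = b ^+ 2 * a ^+ 2 + a ^+ 2 * b ^+ 2 by ring.
  by lra.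
have x0 := enorm_ge0 x; have y0 := enorm_ge0 y.
apply/ler_addgt0Pr => e e0.
pose d := Num.min 1 (e / (enorm x + enorm y + 1)).
have D0 : 0 < enorm x + enorm y + 1 by rewrite ltr_wpDl ?addr_ge0.
have d0 : 0 < d by rewrite lt_min ltr01 divr_gt0.
have d1 : d <= 1 by rewrite /d ge_min lexx.
have dD : d * (enorm x + enorm y + 1) <= e.
  by rewrite -ler_pdivlMr// /d ge_min lexx orbT.
have := key (enorm x + d) (enorm y + d).
rewrite !lerDl (ltW d0) !ltr_wpDl// => /(_ isT isT isT isT) H.
by apply: le_trans H _; nra.
Qed.

Lemma enormD x y : enorm (x + y) <= enorm x + enorm y.
Proof.
rewrite -(@ler_pXn2r _ 2)// ?nnegrE ?addr_ge0 ?enorm_ge0//.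
have -> : (enorm x + enorm y) ^+ 2 =
    enorm x ^+ 2 + enorm y ^+ 2 + 2 * (enorm x * enorm y) by ring.
have -> : enorm (x + y) ^+ 2 =
    enorm x ^+ 2 + enorm y ^+ 2 + 2 * (\sum_j x 0 j * y 0 j).
  rewrite !sqr_enorm mulr_sumr -!big_split/=; apply: eq_bigr => j _.
  by rewrite mxE; ring.
by rewrite lerD2l ler_wpM2l// sum_mul_le_enorm.
Qed.

Lemma enorm_const (a : R) : 0 <= a -> enorm (const_mx a : 'rV[R]_n) = a * Num.sqrt n%:R.
Proof.
move=> a0; rewrite /enorm; under eq_bigr do rewrite mxE.
have -> : \sum_(j < n) a ^+ 2 = a ^+ 2 * n%:R by rewrite sumr_const card_ord mulr_natr.
by rewrite sqrtrM ?sqr_ge0// sqrtr_sqr ger0_norm.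
Qed.

(** The infimum of finitely many [l 0 j] still exceeds the strict lower bound,
    which keeps the closed polydisc inside the open ball. *)
Lemma polydisc_sub_ball (beta : R) (l r : 'rV[R]_n) (z0 z : 'rV[R[i]]_n) :
  0 < beta -> unit_ball R n z0 -> (forall j, beta / (1 - cnorm z0) < l 0 j) ->
  (forall j, 0 <= r 0 j) -> enorm r <= beta ->
  polydisc z0 (vquot r l) z -> unit_ball R n z.
Proof.
rewrite /unit_ball/= => beta0 z0b lb r0 rb zP.
set d := 1 - cnorm z0 in lb; have d0 : 0 < d by rewrite subr_gt0.
have bd0 : 0 < beta / d by rewrite divr_gt0.
pose m := \big[Num.min/beta / d + 1]_j l 0 j.
have m_gt : beta / d < m by apply: lt_bigmin => //; rewrite ltrDl.
have ml j : m <= l 0 j by exact: bigmin_le.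
have m0 : 0 < m by exact: lt_trans m_gt.
pose v : 'rV[R]_n := \row_j cabs (z 0 j - z0 0 j).
have vd : enorm v < d.
  apply: (@le_lt_trans _ _ (enorm (m^-1 *: r))).
    apply: le_enorm => j; rewrite !mxE cabs_ge0/=; apply: le_trans (zP j) _.
    rewrite mxE mulrC ler_wpM2r// lef_pV2// posrE//; exact: lt_le_trans (ml j).
  rewrite enormZ ?invr_ge0 ?(ltW m0)// mulrC ltr_pdivrMr//.
  by apply: le_lt_trans rb _; rewrite mulrC -ltr_pdivrMr.
apply: (@le_lt_trans _ _ (enorm (map_mx (@cabs R) z0 + v))).
  by apply: le_enorm => j; rewrite !mxE cabs_ge0/= cabs_le_dist.
by apply: le_lt_trans (enormD _ _) _; rewrite -/(cnorm z0) -ltrBrDl.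
Qed.

End EuclideanNorm.

(** * Normalized derivatives and the class Q *)

Section NormalizedDerivatives.
Variables (R : realType) (n : nat).
Implicit Types (F : 'rV[R[i]]_n -> R[i]) (L : 'rV[R[i]]_n -> 'rV[R]_n).
Implicit Types (K : multiindex n) (a b : 'rV[R]_n).

Lemma mpow_gt0 a K : (forall j, 0 < a 0 j) -> 0 < mpow a K.
Proof. by move=> a0; apply: prodr_gt0 => j _; rewrite exprn_gt0. Qed.

Lemma mfact_gt0 K : 0 < (mfact K)%:R :> R.
Proof. by rewrite ltr0n prodn_gt0// => j; rewrite fact_gt0. Qed.

Lemma mpow_le a b (c : R) K : (forall j, 0 <= a 0 j <= c * b 0 j) ->
  mpow a K <= c ^+ mdeg K * mpow b K.
Proof.
move=> ab; rewrite expr_mdeg -big_split/=; apply: ler_prod => j _.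
have /andP[a0 acb] := ab j.
by rewrite exprn_ge0//= -exprMn lerXn2r// nnegrE// (le_trans a0).
Qed.

Lemma mpow_madd1 a K j : mpow a (madd1 K j) = a 0 j * mpow a K.
Proof.
rewrite /mpow (bigD1 j)//= [in RHS](bigD1 j)//= mulrA -exprS ffunE eqxx addn1.
by congr (_ * _); apply: eq_bigr => i /negbTE ij; rewrite ffunE ij addn0.
Qed.

Lemma mfact_madd1 K j : mfact (madd1 K j) = ((K j).+1 * mfact K)%N.
Proof.
rewrite /mfact (bigD1 j)//= [in RHS](bigD1 j)//= mulnA -factS ffunE eqxx addn1.
by congr (_ * _)%N; apply: eq_bigr => i /negbTE ij; rewrite ffunE ij addn0.
Qed.

Lemma mdeg_madd1 K j : mdeg (madd1 K j) = (mdeg K).+1.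
Proof.
rewrite /mdeg (bigD1 j)//= [in RHS](bigD1 j)//= ffunE eqxx addn1 addSn.
by congr (_ + _).+1; apply: eq_bigr => i /negbTE ij; rewrite ffunE ij addn0.
Qed.

Lemma mpow_vquot_const (c : R) a K :
  mpow (vquot (const_mx c) a) K = c ^+ mdeg K / mpow a K.
Proof.
rewrite expr_mdeg -prodfV -big_split/=; apply: eq_bigr => j _.
by rewrite !mxE exprMn exprVn.
Qed.

Lemma leq_mdeg K j : (K j <= mdeg K)%N.
Proof. by rewrite /mdeg (bigD1 j)//= leq_addr. Qed.

Lemma mderive0 F : mderive F [ffun=> 0%N] = F.
Proof. by rewrite /mderive; elim: (enum _) => //= j s ->; rewrite ffunE. Qed.

Lemma normalized_derive0 L F z : normalized_derive L F [ffun=> 0%N] z = cabs (F z).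
Proof.
rewrite /normalized_derive mderive0 /mfact /mpow !big1 ?mulr1 ?divr1// => j _;
  by rewrite ffunE ?fact0 ?expr0.
Qed.

Lemma normalized_derive_ge0 L F K z : (forall j, 0 < L z 0 j) ->
  0 <= normalized_derive L F K z.
Proof.
move=> L0; rewrite divr_ge0 ?cabs_ge0// mulr_ge0 ?ler0n//.
exact: ltW (mpow_gt0 K L0).
Qed.

Definition index_max m L F z : R :=
  \big[Num.max/0]_(K : {ffun 'I_n -> 'I_m.+1} | (mdeg [ffun j => K j : nat] <= m)%N)
    normalized_derive L F [ffun j => K j : nat] z.

Lemma le_index_max m L F K z : (mdeg K <= m)%N ->
  normalized_derive L F K z <= index_max m L F z.
Proof.
move=> Km; pose K' : {ffun 'I_n -> 'I_m.+1} := [ffun j => inord (K j)].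
have KE : [ffun j => K' j : nat] = K.
  apply/ffunP => j; rewrite !ffunE inordK// ltnS.
  exact: leq_trans (leq_mdeg K j) Km.
rewrite -{1}KE; apply: (le_bigmax_cond _ (fun K : {ffun 'I_n -> 'I_m.+1} =>
  normalized_derive L F [ffun j => K j : nat] z)).
by rewrite KE.
Qed.

Lemma index_max_le m L F z (B : R) : 0 <= B ->
  (forall K, (mdeg K <= m)%N -> normalized_derive L F K z <= B) ->
  index_max m L F z <= B.
Proof. by move=> B0 HB; apply: bigmax_le => // K /HB. Qed.

Lemma index_max_attained m L F z : (forall j, 0 < L z 0 j) ->
  exists2 K, (mdeg K <= m)%N & index_max m L F z = normalized_derive L F K z.
Proof.
move=> L0; pose K0 : {ffun 'I_n -> 'I_m.+1} := [ffun=> ord0].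
have P0 : (mdeg [ffun j => K0 j : nat] <= m)%N.
  by rewrite /mdeg big1// => j _; rewrite !ffunE.
rewrite /index_max (bigmax_eq_arg _ K0)//; last first.
  by move=> K _; exact: normalized_derive_ge0.
by case: arg_maxP => // K KP _; exists [ffun j => K j : nat].
Qed.

End NormalizedDerivatives.

Section ClassQ.
Variables (R : realType) (n : nat) (beta : R) (L : 'rV[R[i]]_n -> 'rV[R]_n).
Hypotheses (beta_gt0 : 0 < beta) (LQ : class_Q beta L).

Lemma class_Q_gt0 z j : unit_ball R n z -> 0 < L z 0 j.
Proof.
case: LQ => _ _ Lb _ zb; apply: lt_trans (Lb j z zb).
by rewrite divr_gt0// subr_gt0.
Qed.

Lemma class_Q_polydisc (r : 'rV[R]_n) z0 z :
  (forall j, 0 <= r 0 j) -> enorm r <= beta ->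
  unit_ball R n z0 -> polydisc z0 (vquot r (L z0)) z -> unit_ball R n z.
Proof.
case: LQ => _ _ Lb _ r0 rb zb; apply: (polydisc_sub_ball beta_gt0) => // j.
exact: Lb.
Qed.

Lemma class_Q_ratio (r : 'rV[R]_n) : (forall j, 0 <= r 0 j) -> enorm r <= beta ->
  exists lam Lam : R, [/\ 0 < lam, lam <= 1, 1 <= Lam & forall z0 z j,
    unit_ball R n z0 -> polydisc z0 (vquot r (L z0)) z ->
    lam * L z0 0 j <= L z 0 j <= Lam * L z0 0 j].
Proof.
case: LQ => _ _ _ LQr r0 rb.
have /choice[lam Hlam] : forall j, exists lam : R, 0 < lam /\ forall z0 z,
    unit_ball R n z0 -> polydisc z0 (vquot r (L z0)) z -> lam <= L z 0 j / L z0 0 j.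
  move=> j; have [l1 l12 l2] := LQr r r0 rb j.
  have l1fin : lambda1 L r j \is a fin_num.
    by rewrite ge0_fin_numE ?ltW// (le_lt_trans l12).
  exists (fine (lambda1 L r j)); split.
    by rewrite fine_gt0// l1 (le_lt_trans l12).
  move=> z0 z z0b zP; rewrite -lee_fin fineK//; apply: ereal_inf_lbound.
  by exists z0, z.
have /choice[Lam HLam] : forall j, exists Lam : R, forall z0 z,
    unit_ball R n z0 -> polydisc z0 (vquot r (L z0)) z -> L z 0 j / L z0 0 j <= Lam.
  move=> j; have [l1 l12 l2] := LQr r r0 rb j.
  have l2fin : lambda2 L r j \is a fin_num.
    by rewrite ge0_fin_numE// (le_trans _ l12)// ltW.
  exists (fine (lambda2 L r j)) => z0 z z0b zP; rewrite -lee_fin fineK//.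
  by apply: ereal_sup_ubound; exists z0, z.
exists (\big[Num.min/1]_j lam j), (\big[Num.max/1]_j Lam j); split.
- by apply: lt_bigmin => // j _; have [] := Hlam j.
- exact: bigmin_le_id.
- exact: bigmax_ge_id.
move=> z0 z j z0b zP; have L0 := class_Q_gt0 j z0b.
rewrite -(ler_pdivlMr _ _ L0) -(ler_pdivrMr _ _ L0); apply/andP; split.
  by apply: le_trans (bigmin_le _ j _) _; have [_] := Hlam j; apply.
by apply: le_trans (HLam j _ _ z0b zP) _; exact: le_bigmax.
Qed.

End ClassQ.

(** * From the polydisc condition to bounded index *)

Section Sufficiency.
Variables (R : realType) (n : nat) (beta : R) (L : 'rV[R[i]]_n -> 'rV[R]_n).
Variable F : 'rV[R[i]]_n -> R[i].
Hypotheses (beta_gt0 : 0 < beta) (LQ : class_Q beta L).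

(** The segment from [z0] to [z] is cut into [q] equal pieces. As [L] grows by at
    most the factor [Lam] on the polydisc, each point lies in the polydisc of
    radii [r] around its predecessor once [q] exceeds all [c * Lam / r 0 j], a
    bound in which [z0] and [z] do not occur. *)
Lemma polydisc_chain (c : R) (r : 'rV[R]_n) (n0 : nat) (p0 : R) :
  0 < c -> enorm (const_mx c : 'rV[R]_n) <= beta ->
  (forall j, 0 < r 0 j) -> 0 <= p0 ->
  (forall z0, unit_ball R n z0 -> exists2 K0 : multiindex n, (mdeg K0 <= n0)%N &
     (polydisc_max L F n0 z0 r <= (p0 * normalized_derive L F K0 z0)%:E)%E) ->
  exists q : nat, forall z0 z, unit_ball R n z0 ->
    polydisc z0 (vquot (const_mx c) (L z0)) z ->
    cabs (F z) <= p0 ^+ q * index_max n0 L F z0.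
Proof.
move=> c0 cbeta r0 p0_ge0 Hmax.
have c_ge0 j : 0 <= (const_mx c : 'rV[R]_n) 0 j by rewrite mxE ltW.
have [lam [Lam [_ _ Lam1 Hratio]]] := class_Q_ratio beta_gt0 LQ c_ge0 cbeta.
have [q q0 Hq] : exists2 q : nat, (0 < q)%N & forall j, c * Lam <= q%:R * r 0 j.
  exists (Num.truncn (\sum_j c * Lam / r 0 j)).+1 => // j.
  rewrite -ler_pdivrMr//; apply: le_trans (ltW (truncnS_gt _)).
  rewrite (bigD1 j)//= lerDl; apply: sumr_ge0 => i _.
  by rewrite divr_ge0 ?(ltW (r0 i))// mulr_ge0 ?(ltW c0)// (le_trans ler01).
exists q => z0 z z0b zP.
have q0' : 0 < q%:R :> R by rewrite ltr0n.
pose y i : 'rV[R[i]]_n := z0 + (i%:R / q%:R)%:C *: (z - z0).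
have yP i : (i <= q)%N -> polydisc z0 (vquot (const_mx c) (L z0)) (y i).
  move=> iq j; apply: le_trans (zP j).
  have -> : y i 0 j - z0 0 j = (i%:R / q%:R)%:C * (z 0 j - z0 0 j).
    by rewrite !mxE; ring.
  rewrite cabsM cabs_real.
  rewrite ger0_norm ?divr_ge0 ?ler0n// ler_piMl ?cabs_ge0//.
  by rewrite ler_pdivrMr// mul1r ler_nat.
have yb i : (i <= q)%N -> unit_ball R n (y i).
  by move=> /yP; exact: (class_Q_polydisc beta_gt0 LQ).
have ystep i : (i < q)%N -> polydisc (y i) (vquot r (L (y i))) (y i.+1).
  move=> iq j; have /andP[_ Hl] := Hratio z0 (y i) j z0b (yP i (ltnW iq)).
  have l0 := class_Q_gt0 beta_gt0 LQ j z0b.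
  have li := class_Q_gt0 beta_gt0 LQ j (yb i (ltnW iq)).
  have -> : y i.+1 0 j - y i 0 j = (q%:R^-1)%:C * (z 0 j - z0 0 j).
    by rewrite !mxE -natr1 mulrDl mul1r rmorphD/=; ring.
  rewrite cabsM cabs_real gtr0_norm ?invr_gt0// mxE.
  apply: (@le_trans _ _ (q%:R^-1 * (c / L z0 0 j))).
    by rewrite ler_wpM2l ?invr_ge0 ?(ltW q0')//; have := zP j; rewrite !mxE.
  rewrite ler_pdivrMl// mulrA ler_pdivrMr// mulrAC ler_pdivlMr//.
  apply: le_trans (_ : c * (Lam * L z0 0 j) <= _); first by rewrite ler_wpM2l// ltW.
  by rewrite mulrA ler_wpM2r// ltW.
have main i : (i <= q)%N -> forall K, (mdeg K <= n0)%N ->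
    normalized_derive L F K (y i) <= p0 ^+ i * index_max n0 L F z0.
  elim: i => [|i IH] iq K Kn0.
    by rewrite expr0 mul1r /y mul0r scale0r addr0 le_index_max.
  have [K0 K0n HK0] := Hmax _ (yb i (ltnW iq)).
  rewrite exprS -mulrA; apply: le_trans (_ : p0 * normalized_derive L F K0 (y i) <= _).
    rewrite -lee_fin; apply: le_trans HK0; apply: ereal_sup_ubound.
    by exists K, (y i.+1); split => //; exact: ystep.
  by rewrite ler_wpM2l// IH// ltnW.
have := main q (leqnn q) [ffun=> 0%N].
rewrite normalized_derive0 /y divff ?gt_eqF// scale1r addrC subrK; apply.
by rewrite /mdeg big1// => j _; rewrite ffunE.
Qed.

(** Cauchy's estimate at a radius larger than [1] beats the constant coming from
    the chain of polydiscs once the order of the derivative is large. *)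
Lemma bounded_index_of_growth (c : R) (n0 : nat) (P : R) :
  analytic_on_ball F -> 1 < c -> enorm (const_mx c : 'rV[R]_n) <= beta ->
  (forall z0 z, unit_ball R n z0 -> polydisc z0 (vquot (const_mx c) (L z0)) z ->
    cabs (F z) <= P * index_max n0 L F z0) ->
  bounded_L_index L F.
Proof.
move=> HF c1 cbeta HP.
have c0 : 0 < c by exact: lt_trans c1.
(* Bernoulli's inequality provides the exponent *)
have [k Hk] : exists k, P <= c ^+ k.
  exists (Num.truncn (P / (c - 1))).+1.
  apply: le_trans (_ : 1 ^+ _ + _ * (c - 1) * 1 ^+ _.-1 <= _); last first.
    apply: le_trans (bernoulli_remainder _ ler01 _) _; first by rewrite subr_ge0 ltW.
    by rewrite addrC subrK.
  rewrite !expr1n mulr1; apply: le_trans (_ : P / (c - 1) * (c - 1) <= _).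
    by rewrite divfK// subr_eq0 gt_eqF.
  apply: ler_wpDl => //; rewrite ler_wpM2r ?subr_ge0 ?(ltW c1)//.
  exact: ltW (truncnS_gt _).
exists (n0 + k)%N => z J zb; rewrite -/(index_max (n0 + k) L F z).
have L0 j : 0 < L z 0 j by exact: (class_Q_gt0 beta_gt0 LQ).
have [Jk|Jk] := leqP (mdeg J) (n0 + k); first exact: le_index_max.
have M0 : 0 <= index_max n0 L F z.
  have [K _ ->] := index_max_attained n0 F L0; exact: normalized_derive_ge0.
have Mle : index_max n0 L F z <= index_max (n0 + k) L F z.
  have [K Kn ->] := index_max_attained n0 F L0.
  by apply: le_index_max; rewrite (leq_trans Kn) ?leq_addr.
have c_ge0 j : 0 <= (const_mx c : 'rV[R]_n) 0 j by rewrite mxE ltW.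
have := @cauchy_polydisc R n F J (vquot (const_mx c) (L z))
  (P * index_max n0 L F z) z HF.
rewrite mpow_vquot_const => Hc.
have {Hc} : cabs (mderive F J z) * (c ^+ mdeg J / mpow (L z) J) <=
    (mfact J)%:R * (P * index_max n0 L F z).
  apply: Hc => [j|z' zP|z' zP]; first by rewrite !mxE divr_gt0.
    exact: (class_Q_polydisc beta_gt0 LQ c_ge0 cbeta zb zP).
  exact: HP.
have l0 := mpow_gt0 J L0; have f0 := mfact_gt0 R J.
have cJ : 0 < c ^+ mdeg J by rewrite exprn_gt0.
have cPJ : P <= c ^+ mdeg J.
  apply: le_trans Hk _; rewrite ler_eXn2l//.
  by rewrite (leq_trans _ (ltnW Jk))// leq_addl.
move=> Hc; apply: le_trans Mle; rewrite /normalized_derive ler_pdivrMr ?mulr_gt0//.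
rewrite -(ler_pM2r cJ).
have -> : index_max n0 L F z * ((mfact J)%:R * mpow (L z) J) * c ^+ mdeg J =
   (mfact J)%:R * (c ^+ mdeg J * index_max n0 L F z) * mpow (L z) J by ring.
rewrite -ler_pdivrMr// -mulrA; apply: le_trans Hc _.
by rewrite ler_wpM2l ?(ltW f0)// ler_wpM2r.
Qed.

End Sufficiency.

(** * From bounded index to the polydisc condition *)

Section Necessity.
Variables (R : realType) (n : nat) (L : 'rV[R[i]]_n -> 'rV[R]_n).
Variables (F : 'rV[R[i]]_n -> R[i]) (m : nat).
Hypothesis HF : analytic_on_ball F.

(** With a fixed normalizing vector these are moduli of functions that are
    differentiable along segments; [L] is merely continuous, so the quotients
    [normalized_derive] are not. *)
Definition scaled_derive (l : 'rV[R]_n) (K : multiindex n) z : R :=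
  cabs (mderive F K z) / ((mfact K)%:R * mpow l K).

Lemma normalized_le_scaled (l : 'rV[R]_n) (lam : R) (w : 'rV[R[i]]_n)
    (K : multiindex n) :
  (forall i, 0 < l 0 i) -> (forall i, 0 < L w 0 i) -> 0 < lam -> lam <= 1 ->
  (forall i, lam * l 0 i <= L w 0 i) -> (mdeg K <= m)%N ->
  normalized_derive L F K w <= scaled_derive l K w / lam ^+ m.
Proof.
move=> l0 Lw0 lam0 lam1 Hl Km; have lamK k : 0 < lam ^+ k by rewrite exprn_gt0.
have f0 := mfact_gt0 R K; have lK := mpow_gt0 K l0.
rewrite /normalized_derive /scaled_derive -mulrA -invfM ler_wpM2l ?cabs_ge0//.
rewrite lef_pV2 ?posrE ?mulr_gt0 ?mpow_gt0//.
rewrite -mulrA ler_wpM2l ?ler0n//.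
have := @mpow_le R n l (L w) lam^-1 K; rewrite exprVn ler_pdivlMl// => HK.
apply: le_trans (HK _) => [|i]; last by rewrite ltW//= ler_pdivlMl.
by rewrite mulrC ler_wpM2r ?(ltW lK)// ler_wiXn2l// ltW.
Qed.

(** Along a coordinate segment the derivatives of order at most [m] control,
    through the bounded index, those of order [m + 1], hence their own speed. *)
Lemma coordinate_growth (l : 'rV[R]_n) (lam Lam A : R) z j (d : R[i]) :
  (forall i, 0 < l 0 i) -> 0 < lam -> lam <= 1 -> 1 <= Lam -> 0 <= A ->
  let w t := z + (t%:C * d) *: delta_mx 0 j in
  (forall t, 0 <= t <= 1 -> unit_ball R n (w t)) ->
  (forall t i, 0 <= t <= 1 -> lam * l 0 i <= L (w t) 0 i <= Lam * l 0 i) ->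
  (forall t K, 0 <= t <= 1 ->
     normalized_derive L F K (w t) <= index_max m L F (w t)) ->
  cabs d * l 0 j * (m.+1%:R * Lam ^+ m.+1 / lam ^+ m) <= 2^-1 ->
  (forall K, (mdeg K <= m)%N -> scaled_derive l K z <= A) ->
  forall K, (mdeg K <= m)%N -> scaled_derive l K (z + d *: delta_mx 0 j) <= A * 2.
Proof.
move=> l0 lam0 lam1 Lam1 A0 w wb wl windex dsmall HA K Km.
pose emb (K : {ffun 'I_n -> 'I_m.+1}) : multiindex n := [ffun j => K j : nat].
pose K' : {ffun 'I_n -> 'I_m.+1} := [ffun j => inord (K j)].
have KE : emb K' = K.
  by apply/ffunP => i; rewrite !ffunE inordK// ltnS (leq_trans (leq_mdeg K i)).
pose nrm (J : multiindex n) : R := (mfact J)%:R * mpow l J.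
have nrm0 J : 0 < nrm J by rewrite mulr_gt0 ?mfact_gt0 ?mpow_gt0.
pose f (J : {ffun 'I_n -> 'I_m.+1}) t :=
  ((nrm (emb J))^-1)%:C * mderive F (emb J) (w t).
pose f' (J : {ffun 'I_n -> 'I_m.+1}) t :=
  ((nrm (emb J))^-1)%:C * (d * mderive F (madd1 (emb J) j) (w t)).
have cf J t : cabs (f J t) = scaled_derive l (emb J) (w t).
  by rewrite /f cabsM cabs_real gtr0_norm ?invr_gt0// mulrC.
have := @family_growth R _ (fun J => mdeg (emb J) <= m)%N f f' A A0.
have w1 : w 1 = z + d *: delta_mx 0 j by rewrite /w mul1r.
rewrite -w1 -KE -cf => H; apply: H; last by rewrite KE.
- move=> J _; apply: has_rderivZ => t tT eps eps0.
  have d0 : 0 < cabs d + 1 by rewrite ltr_wpDl ?cabs_ge0.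
  have HJ : analytic_on_ball (mderive F (emb J)) by exact: analytic_foldr.
  have [e e0 He] := analytic_cderiv j HJ (wb t tT) (divr_gt0 eps0 d0).
  exists (e / (cabs d + 1)) => [|s sT]; first by rewrite divr_gt0.
  rewrite ltr_pdivlMr// => std; have := He ((s - t)%:C * d).
  rewrite partial_mderive//; last exact: wb.
  have -> : w t + ((s - t)%:C * d) *: delta_mx 0 j = w s.
    by rewrite /w -addrA -scalerDl; congr (z + _ *: _); rewrite rmorphB/=; ring.
  rewrite -(mulrA _ d) cabsM cabs_real => Hd; apply: le_trans (Hd _) _.
    by apply: le_lt_trans std; rewrite ler_wpM2l// lerDl.
  have -> : eps / (cabs d + 1) * (`|s - t| * cabs d) =
    (eps * `|s - t|) * (cabs d / (cabs d + 1)) by ring.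
  by rewrite ler_piMr ?mulr_ge0 ?(ltW eps0)// ler_pdivrMr// mul1r lerDl.
- by move=> J Jm; rewrite cf /w mul0r scale0r addr0; exact: HA.
move=> t B tT HB J Jm.
have B0 : 0 <= B.
  by apply: le_trans (HB J Jm); exact: cabs_ge0.
have Lw0 i : 0 < L (w t) 0 i.
  by have /andP[+ _] := wl t i tT; apply: lt_le_trans; rewrite mulr_gt0.
have lamm : 0 < lam ^+ m by rewrite exprn_gt0.
have MB : index_max m L F (w t) <= B / lam ^+ m.
  apply: index_max_le => [|I Im]; first by rewrite divr_ge0// ltW.
  have /HB : (mdeg (emb [ffun j => inord (I j)]) <= m)%N.
    rewrite (_ : emb _ = I)//; apply/ffunP => i; rewrite !ffunE inordK// ltnS.
    exact: leq_trans (leq_mdeg I i) Im.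
  rewrite cf (_ : emb _ = I) => [HI|]; last first.
    apply/ffunP => i; rewrite !ffunE inordK// ltnS; exact: leq_trans (leq_mdeg I i) Im.
  apply: le_trans (normalized_le_scaled l0 Lw0 lam0 lam1 _ Im) _.
    by move=> i; have /andP[] := wl t i tT.
  by rewrite ler_wpM2r// invr_ge0 ltW.
have := le_trans (windex t (madd1 (emb J) j) tT) MB.
rewrite /normalized_derive ler_pdivrMr ?mulr_gt0 ?mfact_gt0 ?mpow_gt0// => HJ.
have LamJ : mpow (L (w t)) (madd1 (emb J) j) <= Lam ^+ m.+1 * (l 0 j * mpow l (emb J)).
  rewrite -mpow_madd1; apply: le_trans (@mpow_le R n _ l Lam _ _) _.
    by move=> i; rewrite ltW//=; have /andP[] := wl t i tT.
  rewrite ler_wpM2r ?(ltW (mpow_gt0 _ l0))// ler_weXn2l//.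
  by rewrite mdeg_madd1.
rewrite /f' !cabsM cabs_real gtr0_norm ?invr_gt0//.
rewrite ler_pdivrMl//.
apply: le_trans (ler_wpM2l (cabs_ge0 d) HJ) _.
rewrite mfact_madd1 natrM.
apply: (@le_trans _ _ (cabs d * (B / lam ^+ m *
    (m.+1%:R * (mfact (emb J))%:R * (Lam ^+ m.+1 * (l 0 j * mpow l (emb J))))))).
  rewrite ler_wpM2l ?cabs_ge0// ler_wpM2l ?divr_ge0 ?(ltW lamm)//.
  rewrite ler_pM ?mulr_ge0 ?(ltW (mpow_gt0 _ Lw0))//.
  by rewrite ler_wpM2r ?ler0n// ler_nat ltnS (leq_trans (leq_mdeg _ j)).
have -> : cabs d * (B / lam ^+ m *
    (m.+1%:R * (mfact (emb J))%:R * (Lam ^+ m.+1 * (l 0 j * mpow l (emb J))))) =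
  (nrm (emb J) * B) * (cabs d * l 0 j * (m.+1%:R * Lam ^+ m.+1 / lam ^+ m)).
  by rewrite /nrm; ring.
by rewrite [leRHS]mulrA ler_wpM2l// mulr_ge0// ltW.
Qed.

(** Changing the coordinates one at a time, each change costs a factor [2]. *)
Lemma polydisc_growth (rho : 'rV[R]_n) (lam Lam A : R) z0 z :
  let l := L z0 in
  (forall i, 0 < l 0 i) -> 0 < lam -> lam <= 1 -> 1 <= Lam -> 0 <= A ->
  (forall w, polydisc z0 rho w -> unit_ball R n w) ->
  (forall w i, polydisc z0 rho w -> lam * l 0 i <= L w 0 i <= Lam * l 0 i) ->
  (forall w K, polydisc z0 rho w -> normalized_derive L F K w <= index_max m L F w) ->
  (forall j, rho 0 j * l 0 j * (m.+1%:R * Lam ^+ m.+1 / lam ^+ m) <= 2^-1) ->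
  polydisc z0 rho z ->
  (forall K, (mdeg K <= m)%N -> scaled_derive l K z0 <= A) ->
  forall K, (mdeg K <= m)%N -> scaled_derive l K z <= A * 2 ^+ n.
Proof.
move=> l l0 lam0 lam1 Lam1 A0 Pball Pratio Pindex small zP HA.
pose mix (s : seq 'I_n) : 'rV[R[i]]_n := \row_i (if i \in s then z 0 i else z0 0 i).
have rho0 j : 0 <= rho 0 j by apply: le_trans (zP j); exact: cabs_ge0.
have mixP s i : cabs (mix s 0 i - z0 0 i) <= rho 0 i.
  by rewrite mxE; case: ifP => _; [exact: zP|rewrite subrr cabs0].
suff main s : uniq s -> forall K, (mdeg K <= m)%N ->
    scaled_derive l K (mix s) <= A * 2 ^+ size s.
  have <- : mix (enum 'I_n) = z by apply/rowP => i; rewrite mxE mem_enum.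
  by have := main (enum 'I_n) (enum_uniq _); rewrite size_enum_ord.
elim: s => [_ K /HA|j s IH /= /andP[js us]].
  rewrite expr0 mulr1 (_ : mix [::] = z0)//.
  by apply/rowP => i; rewrite mxE.
rewrite exprSr mulrA.
have -> : mix (j :: s) = mix s + (z 0 j - z0 0 j) *: delta_mx 0 j.
  apply/rowP => i; rewrite !mxE inE eqxx/=.
  have [->|ij] := eqVneq i j; last by rewrite mulr0 addr0.
  by rewrite (negbTE js) /= mulr1 addrC subrK.
pose w t := mix s + (t%:C * (z 0 j - z0 0 j)) *: delta_mx 0 j.
have wP t : 0 <= t <= 1 -> polydisc z0 rho (w t).
  move=> /andP[t0 t1] i.
  have -> : w t 0 i = mix s 0 i + t%:C * (z 0 j - z0 0 j) * (i == j)%:R.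
    by rewrite !mxE eqxx.
  have [->|ij] := eqVneq i j; last by rewrite mulr0 addr0; exact: mixP.
  rewrite mxE (negbTE js) mulr1 addrAC subrr add0r cabsM cabs_real ger0_norm//.
  by apply: le_trans (zP j); rewrite ler_piMl ?cabs_ge0.
apply: (@coordinate_growth l lam Lam (A * 2 ^+ size s) (mix s) j _)
    => //.
- by rewrite mulr_ge0 ?exprn_ge0.
- by move=> t /wP/Pball.
- by move=> t i /wP; exact: Pratio.
- by move=> t K /wP; exact: Pindex.
- apply: le_trans (small j); apply: ler_wpM2r.
    by rewrite divr_ge0 ?mulr_ge0 ?exprn_ge0 ?(ltW lam0)// (le_trans ler01).
  by apply: ler_wpM2r; [exact: ltW|exact: zP].
- exact: IH.
Qed.

End Necessity.

(** * The criterion *)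

Theorem theorem4 (R : realType) (n : nat) (n_gt0 : (0 < n)%N)
    (beta : R) (beta_gt : Num.sqrt n%:R < beta)
    (L : 'rV[R[i]]_n -> 'rV[R]_n) (LQ : class_Q beta L)
    (F : 'rV[R[i]]_n -> R[i]) (Fanalytic : analytic_on_ball F) :
  bounded_L_index L F <->
  exists (r : 'rV[R]_n) (n0 : nat) (p0 : R),
    [/\ forall j, 0 < r 0 j, enorm r <= beta, 1 < p0 &
      forall z0, unit_ball R n z0 ->
        exists2 K0 : multiindex n, (mdeg K0 <= n0)%N &
          (polydisc_max L F n0 z0 r <= (p0 * normalized_derive L F K0 z0)%:E)%E].
Proof.
have sn0 : 0 < Num.sqrt n%:R :> R by rewrite sqrtr_gt0 ltr0n.
have beta0 : 0 < beta := lt_trans sn0 beta_gt.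
split.
- move=> [m Hm].
  (* the ratio bounds for radii [1] serve for all smaller radii [tau] *)
  have one_ge0 j : 0 <= (const_mx 1 : 'rV[R]_n) 0 j by rewrite mxE.
  have one_beta : enorm (const_mx 1 : 'rV[R]_n) <= beta.
    by rewrite enorm_const// mul1r ltW.
  have [lam [Lam [lam0 lam1 Lam1 Hratio]]] := class_Q_ratio beta0 LQ one_ge0 one_beta.
  have Lam0 : 0 < Lam := lt_le_trans ltr01 Lam1.
  have lamm : 0 < lam ^+ m by rewrite exprn_gt0.
  (* [C] is the constant of [polydisc_growth]; [tau] makes the product [1 / 2] *)
  pose C := m.+1%:R * Lam ^+ m.+1 / lam ^+ m.
  have C1 : 1 <= C.
    rewrite ler_pdivlMr// mul1r; apply: (@le_trans _ _ 1).
      by rewrite exprn_ile1// ltW.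
    by rewrite mulr_ege1 ?exprn_ege1// ler1n.
  have C0 : 0 < C := lt_le_trans ltr01 C1.
  pose tau := (2 * C)^-1.
  have tau0 : 0 < tau by rewrite invr_gt0 mulr_gt0.
  have tau1 : tau <= 1.
    have C2 : 0 < 2 * C by rewrite mulr_gt0.
    by rewrite /tau (invf_le1 C2) mulr_ege1// ler1n.
  exists (const_mx tau), m, (2 ^+ n / lam ^+ m + 1); split.
  + by move=> j; rewrite mxE.
  + by rewrite enorm_const ?(ltW tau0)// (le_trans _ (ltW beta_gt))// ler_piMl// ltW.
  + by rewrite ltrDr divr_gt0// exprn_gt0.
  move=> z0 z0b; have l0 j : 0 < L z0 0 j := class_Q_gt0 beta0 LQ j z0b.
  have [K0 K0m HK0] := index_max_attained m F l0.
  have A0 : 0 <= index_max m L F z0 by rewrite HK0 normalized_derive_ge0.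
  have sub w : polydisc z0 (vquot (const_mx tau) (L z0)) w ->
      polydisc z0 (vquot (const_mx 1) (L z0)) w.
    move=> wP j; apply: le_trans (wP j) _; rewrite !mxE.
    by rewrite ler_wpM2r// invr_ge0 ltW.
  exists K0 => //; rewrite -HK0; apply: ge_ereal_sup => _ [K [z [Km zP ->]]].
  rewrite lee_fin.
  have := @polydisc_growth R n L F m Fanalytic (vquot (const_mx tau) (L z0)) lam Lam
    (index_max m L F z0) z0 z l0 lam0 lam1 Lam1 A0.
  move=> /(_ _ _ _ _ zP _ K Km) H.
  have {H} Hz : scaled_derive F (L z0) K z <= index_max m L F z0 * 2 ^+ n.
    apply: H => [w wP|w i wP|w I wP|j|I Im].
    + exact: (class_Q_polydisc beta0 LQ one_ge0 one_beta z0b (sub w wP)).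
    + exact: Hratio z0b (sub w wP).
    + exact: Hm (class_Q_polydisc beta0 LQ one_ge0 one_beta z0b (sub w wP)).
    + rewrite !mxE divfK ?gt_eqF// -/C /tau invfM -mulrA mulVf ?mulr1//.
      by rewrite gt_eqF.
    + exact: le_index_max.
  have zb := class_Q_polydisc beta0 LQ one_ge0 one_beta z0b (sub z zP).
  have Lz0 j : 0 < L z 0 j := class_Q_gt0 beta0 LQ j zb.
  apply: (@le_trans _ _ (scaled_derive F (L z0) K z / lam ^+ m)).
    apply: normalized_le_scaled => // j.
    by have /andP[] := Hratio z0 z j z0b (sub z zP).
  rewrite ler_pdivrMr//; apply: le_trans Hz _.
  rewrite mulrAC mulrDl divfK ?gt_eqF// mulrC ler_wpM2r// lerDl mul1r.
  exact: ltW.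
- move=> [r [n0 [p0 [r0 rbeta p01 Hmax]]]].
  (* equal radii of Euclidean norm [beta], above [1] because [sqrt n < beta] *)
  pose c := beta / Num.sqrt n%:R.
  have c1 : 1 < c by rewrite ltr_pdivlMr// mul1r.
  have c0 : 0 < c := lt_trans ltr01 c1.
  have cbeta : enorm (const_mx c : 'rV[R]_n) <= beta.
    by rewrite enorm_const ?(ltW c0)// /c divfK// gt_eqF.
  have [q Hq] := polydisc_chain beta0 LQ c0 cbeta r0 (ltW (lt_trans ltr01 p01)) Hmax.
  exact: (bounded_index_of_growth beta0 LQ Fanalytic c1 cbeta Hq).
Qed.
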